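(* Let $G=\langle a,b\rangle\le \mathrm{Aut}(T)$ be the group generated by the recursively defined automorphisms $a=(1,b)$, $b=(1,a)\varepsilon$ of the rooted binary tree $T$. Fix $r>0$ and let $(Z_n)_{n\ge 0}$ be the random walk on $G$ started at $1$ whose steps are chosen from $(a,a^{-1},b,b^{-1})$ with probabilities proportional to $(1,1,r,r)$. Let $M_n=\max(|Z_1|,\dots,|Z_n|)$. Then there exists $c>0$ such that for all real $\lambda\ge 1$ and all integers $n\ge 1$ $$\mathbf{P}\big(M_n>\lambda n^{5/6}\big)<\frac{c}{\lambda}.$$
   Context: $T$ is the rooted binary tree with vertex set $V$ consisting of all finite binary sequences and edge set $\{(v,vi): v\in V,\ i\in\{0,1\}\}$. Automorphisms act on the right, written $g: v\mapsto v^g$, so $v^{gh}=(v^g)^h$. For $g,h\in\mathrm{Aut}(T)$, $(g,h)$ denotes the automorphism sending $0v\mapsto 0v^g$ and $1v\mapsto 1v^h$. The automorphism $\varepsilon$ sends $iv$ to $((i+1)\bmod 2)v$ for $i\in\{0,1\}$. The elements $a,b$ are the unique automorphisms satisfying $a=(1,b)$ and $b=(1,a)\varepsilon$. $|g|$ denotes the word length of $g\in G$ with respect to the generating set $\{a^{\pm1},b^{\pm1}\}$. The random walk is $Z_n=s_1s_2\cdots s_n$ with $s_i$ i.i.d. steps. *)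

(* Defs.v *)
From HB Require Import structures.
From mathcomp Require Import all_boot all_order all_algebra.
From mathcomp Require Import all_classical all_reals all_analysis.

Set Implicit Arguments.
Unset Strict Implicit.
Unset Printing Implicit Defensive.

Import Order.TTheory GRing.Theory Num.Theory.
Local Open Scope classical_set_scope.
Local Open Scope group_scope.

(* [false] and [true] are the letters 0 and 1; the root is [[::]]. *)
Definition vertex := seq bool.

Definition tree_edge (u v : vertex) : Prop := exists i : bool, v = rcons u i.

(* Edges point away from the root, so the root, being the only vertex without
   an incoming edge, is automatically fixed. *)
Definition tree_automorphism : set (vertex -> vertex) :=
  [set f : vertex -> vertex | bijective f /\
           forall u v, tree_edge u v <-> tree_edge (f u) (f v)].

Record tree_aut := TreeAut {
  aut_fun :> vertex -> vertex;
  aut_funP : aut_fun \in tree_automorphism }.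

HB.instance Definition _ := [isSub for aut_fun].
HB.instance Definition _ := [Choice of tree_aut by <:].

Lemma tree_aut_eq (g h : tree_aut) : g =1 h -> g = h.
Proof. by move=> gh; apply: val_inj; apply/funext. Qed.

Lemma tree_aut_bij (g : tree_aut) : bijective g.
Proof. by have := aut_funP g; rewrite inE => -[]. Qed.

Lemma tree_aut_edge (g : tree_aut) u v :
  tree_edge u v <-> tree_edge (g u) (g v).
Proof. by have := aut_funP g; rewrite inE => -[_]; apply. Qed.

Lemma tree_automorphism_inv f f' : cancel f f' -> cancel f' f ->
  f \in tree_automorphism -> f' \in tree_automorphism.
Proof.
move=> fK f'K; rewrite !inE => -[_ fE]; split; first by exists f.
by move=> u v; rewrite [tree_edge (f' u) _]fE !f'K.
Qed.

Lemma tree_automorphism_children f f' : cancel f f' -> cancel f' f ->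
  (forall u v, tree_edge u v -> tree_edge (f u) (f v)) ->
  (forall u v, tree_edge u v -> tree_edge (f' u) (f' v)) ->
  f \in tree_automorphism.
Proof.
move=> fK f'K fE f'E; rewrite inE; split; first by exists f'.
by move=> u v; split=> [/fE//|/f'E]; rewrite !fK.
Qed.

Fact aut_one_subproof : id \in tree_automorphism.
Proof. by rewrite inE; split=> //; exists id. Qed.
Definition aut_one := TreeAut aut_one_subproof.

(* Automorphisms act on the right: [g * h] is "first g, then h". *)
Fact aut_mul_subproof (g h : tree_aut) : h \o g \in tree_automorphism.
Proof.
rewrite inE; split; first exact: bij_comp (tree_aut_bij h) (tree_aut_bij g).
move=> u v; exact: iff_trans (tree_aut_edge g u v) (tree_aut_edge h _ _).
Qed.
Definition aut_mul (g h : tree_aut) := TreeAut (aut_mul_subproof g h).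

Fact aut_inv_ex (g : tree_aut) : exists h : tree_aut, cancel g h /\ cancel h g.
Proof.
have [f gK fK] := tree_aut_bij g.
by exists (TreeAut (tree_automorphism_inv gK fK (aut_funP g))).
Qed.
Definition aut_inv (g : tree_aut) : tree_aut := sval (cid (aut_inv_ex g)).

Fact aut_mulA : associative aut_mul.
Proof. by move=> g h k; apply: tree_aut_eq. Qed.
Fact aut_mul1 : left_id aut_one aut_mul.
Proof. by move=> g; apply: tree_aut_eq. Qed.
Fact aut_mulr1 : right_id aut_one aut_mul.
Proof. by move=> g; apply: tree_aut_eq. Qed.
Fact aut_mulV : left_inverse aut_one aut_inv aut_mul.
Proof.
by move=> g; apply: tree_aut_eq => v /=; rewrite /aut_inv; case: cid => h [] /=.
Qed.
Fact aut_mulrV : right_inverse aut_one aut_inv aut_mul.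
Proof.
by move=> g; apply: tree_aut_eq => v /=; rewrite /aut_inv; case: cid => h [] /=.
Qed.

HB.instance Definition _ := isGroup.Build tree_aut
  aut_mulA aut_mul1 aut_mulr1 aut_mulV aut_mulrV.

Lemma tree_aut_mulE (g h : tree_aut) v : (g * h) v = h (g v).
Proof. by []. Qed.

(* [pair_aut g h] below is the automorphism written (g, h), and [flip_aut] the
   one written epsilon. *)
Definition pair_fun (f f' : vertex -> vertex) (v : vertex) : vertex :=
  match v with
  | [::] => [::]
  | false :: w => false :: f w
  | true :: w => true :: f' w
  end.

Definition flip_fun (v : vertex) : vertex :=
  if v is i :: w then ~~ i :: w else [::].

Lemma tree_aut_root (g : tree_aut) : g [::] = [::].
Proof.
have [h gK hK] := tree_aut_bij g.
case/lastP Eg : (g [::]) => [//|u i].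
have [|j] := (tree_aut_edge g (h u) [::]).2; first by exists i; rewrite hK.
by move/(congr1 size); rewrite size_rcons.
Qed.

Lemma pair_fun_edge (g h : tree_aut) u v :
  tree_edge u v -> tree_edge (pair_fun g h u) (pair_fun g h v).
Proof.
case=> i ->; case: u => [|[] u] /=.
- by exists i; case: i; rewrite /= tree_aut_root.
- have [|j ->] := (tree_aut_edge h u (rcons u i)).1; first by exists i.
  by exists j.
- have [|j ->] := (tree_aut_edge g u (rcons u i)).1; first by exists i.
  by exists j.
Qed.

Fact pair_aut_subproof (g h : tree_aut) : pair_fun g h \in tree_automorphism.
Proof.
apply: (@tree_automorphism_children _
    (pair_fun (g^-1 : tree_aut)%g (h^-1 : tree_aut)%g));
  try exact: pair_fun_edge.
- by case=> [|[] v] //=; rewrite -tree_aut_mulE mulgV.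
- by case=> [|[] v] //=; rewrite -tree_aut_mulE mulVg.
Qed.
Definition pair_aut (g h : tree_aut) : tree_aut :=
  TreeAut (pair_aut_subproof g h).

Fact flip_aut_subproof : flip_fun \in tree_automorphism.
Proof.
have flipK : involutive flip_fun by case=> [|i v] //=; rewrite negbK.
have flipE u v : tree_edge u v -> tree_edge (flip_fun u) (flip_fun v).
  by case=> i ->; case: u => [|j u] /=; [exists (~~ i)|exists i].
exact: (@tree_automorphism_children _ flip_fun).
Qed.
Definition flip_aut : tree_aut := TreeAut flip_aut_subproof.

(* The recursion a = (1, b), b = (1, a) epsilon unfolded on vertices; [aut_aE],
   [aut_bE] and [aut_ab_unique] show that it defines a and b. *)
Fixpoint a_fun (v : vertex) : vertex :=
  match v with
  | [::] => [::]
  | false :: w => false :: w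
  | true :: w => true :: b_fun w
  end
with b_fun (v : vertex) : vertex :=
  match v with
  | [::] => [::]
  | false :: w => true :: w
  | true :: w => false :: a_fun w
  end.

Fixpoint a_inv_fun (v : vertex) : vertex :=
  match v with
  | [::] => [::]
  | false :: w => false :: w
  | true :: w => true :: b_inv_fun w
  end
with b_inv_fun (v : vertex) : vertex :=
  match v with
  | [::] => [::]
  | true :: w => false :: w
  | false :: w => true :: a_inv_fun w
  end.

Fact ab_fun_automorphism :
  a_fun \in tree_automorphism /\ b_fun \in tree_automorphism.
Proof.
have K v : (a_inv_fun (a_fun v) = v /\ b_inv_fun (b_fun v) = v) /\
           (a_fun (a_inv_fun v) = v /\ b_fun (b_inv_fun v) = v).
  by elim: v => [|[] v [[ha hb] [ha' hb']]] /=; rewrite ?ha ?hb ?ha' ?hb'.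
have E u i : (tree_edge (a_fun u) (a_fun (rcons u i)) /\
              tree_edge (b_fun u) (b_fun (rcons u i))) /\
             (tree_edge (a_inv_fun u) (a_inv_fun (rcons u i)) /\
              tree_edge (b_inv_fun u) (b_inv_fun (rcons u i))).
  elim: u => [|[] u [[[j1 h1] [j2 h2]] [[j3 h3] [j4 h4]]]] /=.
  - by case: i; do !split; rewrite /tree_edge /=; by [exists true|exists false].
  - rewrite h1 h2 h4; do !split;
      by [exists j1|exists j2|exists j3|exists j4|exists i].
  - rewrite h3; do !split;
      by [exists j1|exists j2|exists j3|exists j4|exists i].
split; [apply: (@tree_automorphism_children _ a_inv_fun)
       |apply: (@tree_automorphism_children _ b_inv_fun)];
  try by [move=> v; case: (K v) => -[]|
          move=> u _ [i ->]; case: (E u i) => -[]].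
- by move=> v; case: (K v) => _ [].
- by move=> u _ [i ->]; case: (E u i) => _ [].
- by move=> v; case: (K v) => _ [].
- by move=> u _ [i ->]; case: (E u i) => _ [].
Qed.

Definition aut_a : tree_aut := TreeAut ab_fun_automorphism.1.
Definition aut_b : tree_aut := TreeAut ab_fun_automorphism.2.

Lemma aut_aE : aut_a = pair_aut 1 aut_b.
Proof. by apply: tree_aut_eq => -[|[] v]. Qed.

Lemma aut_bE : aut_b = pair_aut 1 aut_a * flip_aut.
Proof. by apply: tree_aut_eq => -[|[] v]. Qed.

Lemma aut_ab_unique (a b : tree_aut) :
  a = pair_aut 1 b -> b = pair_aut 1 a * flip_aut -> a = aut_a /\ b = aut_b.
Proof.
move=> aE bE.
have ab v : a v = aut_a v /\ b v = aut_b v.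
  elim: v => [|i v [ha hb]]; first by rewrite !tree_aut_root.
  rewrite aE {2}bE tree_aut_mulE /=.
  by case: i; rewrite /= ?ha ?hb.
by split; apply: tree_aut_eq => v; case: (ab v).
Qed.

Definition ab_group : set tree_aut :=
  smallest [set H : set tree_aut | group_closed [in H]] [set aut_a; aut_b].

Fact ab_group_closed : group_closed [in ab_group].
Proof.
split=> [|x y]; rewrite !inE; first by move=> H [[+ _] _]; rewrite inE.
move=> xG yG H HP; have [[_ HD] _] := HP.
by rewrite -in_setE; apply: HD; rewrite in_setE; [apply: xG|apply: yG].
Qed.

Record basilica := Basilica {
  basilica_val :> tree_aut;
  basilica_valP : basilica_val \in ab_group }.

HB.instance Definition _ := [isSub for basilica_val].
HB.instance Definition _ := [Choice of basilica by <:].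
HB.instance Definition _ :=
  SubChoice_isSubGroup.Build tree_aut (fun g => g \in ab_group) basilica
    ab_group_closed.

HB.instance Definition _ := isPointed.Build basilica (1 : basilica).

HB.instance Definition _ := @isMeasurable.Build default_measure_display
  basilica discrete_measurable discrete_measurable0
  discrete_measurableC discrete_measurableU.

Fact aut_a_in : aut_a \in ab_group.
Proof. by rewrite inE; apply: sub_gen_smallest; left. Qed.
Fact aut_b_in : aut_b \in ab_group.
Proof. by rewrite inE; apply: sub_gen_smallest; right. Qed.
Definition gen_a : basilica := Basilica aut_a_in.
Definition gen_b : basilica := Basilica aut_b_in.

Definition is_word (G : groupType) (S : set G) (g : G) (n : nat) : Prop :=
  exists w : seq G, [/\ size w = n,
    forall x, x \in w -> S x \/ S x^-1 & g = \prod_(x <- w) x].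

(* The value is irrelevant when [g] is not a product of elements of S and
   their inverses; see [basilica_is_word]. *)
Definition word_length (G : groupType) (S : set G) (g : G) : nat :=
  if pselect (exists n, `[< is_word S g n >]) is left e then ex_minn e else 0%N.

Lemma basilica_is_word (g : basilica) :
  exists n, is_word [set gen_a; gen_b] g n.
Proof.
pose H : set tree_aut := [set h | exists (g : basilica) n,
  h = \val g /\ is_word [set gen_a; gen_b] g n].
suff sGH : ab_group `<=` H.
  have := basilica_valP g; rewrite inE => /sGH [g' [n [/val_inj -> gn]]].
  by exists n.
apply: smallest_sub; last first.
  move=> _ [] ->; [exists gen_a, 1%N|exists gen_b, 1%N]; split=> //.
  - exists [:: gen_a]; split; rewrite ?big_seq1 // => x.
    by rewrite inE => /eqP ->; left; left.
  - exists [:: gen_b]; split; rewrite ?big_seq1 // => x.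
    by rewrite inE => /eqP ->; left; right.
split=> [|x y]; rewrite !inE.
  exists 1, 0%N; split; first by rewrite gmulf1.
  by exists [::]; split=> //; rewrite big_nil.
move=> [g1 [_ [-> [w1 [_ h1 ->]]]]] [g2 [_ [-> [w2 [_ h2 ->]]]]].
exists ((\prod_(x <- w1) x) / (\prod_(x <- w2) x)), (size w1 + size w2)%N.
split; first by rewrite gmulfF.
exists (w1 ++ rev [seq x^-1 | x <- w2]); split.
- by rewrite size_cat size_rev size_map.
- move=> z; rewrite mem_cat => /orP[/h1//|].
  by rewrite mem_rev => /mapP[t /h2 ht ->]; rewrite invgK; case: ht; [right|left].
- by rewrite big_cat /= -map_rev big_map prodgV revK.
Qed.

Section RandomWalk.
Context (R : realType) (d : measure_display) (T : measurableType d)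
  (P : probability T R).
Local Open Scope ereal_scope.

Definition mutually_independent d' (U : measurableType d')
    (X : nat -> {RV P >-> U}) : Prop :=
  forall (J : seq nat) (A : nat -> set U), uniq J ->
    (forall i, measurable (A i)) ->
    P (\bigcap_(i in [set` J]) (X i @^-1` A i)) =
    \prod_(i <- J) P (X i @^-1` A i).

(* The law on G giving a, a^-1, b, b^-1 weights 1, 1, r, r up to
   normalization. *)
Definition step_law (r : R) (A : set basilica) : \bar R :=
  ((2 + 2 * r)^-1)%R%:E *
  (dirac gen_a A + dirac gen_a^-1%g A
   + r%:E * dirac gen_b A + r%:E * dirac gen_b^-1%g A).

(* [s i] is the step s_{i+1}. *)
Definition walk_steps (r : R) (s : nat -> {RV P >-> basilica}) : Prop :=
  (forall i A, distribution P (s i) A = step_law r A) /\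
  mutually_independent s.

Definition walk (s : nat -> {RV P >-> basilica}) (n : nat) (w : T) : basilica :=
  (\prod_(i < n) s i w)%g.

Definition walk_max (s : nat -> {RV P >-> basilica}) (n : nat) (w : T) : nat :=
  \max_(1 <= i < n.+1) word_length [set gen_a; gen_b] (walk s i w).

End RandomWalk.

(* Main.v *)
Require Import Defs.
From mathcomp Require Import all_boot all_order all_algebra.
From mathcomp Require Import all_classical all_reals all_analysis.
From mathcomp Require Import ring lra zify.

Set Implicit Arguments.
Unset Strict Implicit.
Unset Printing Implicit Defensive.

Import Order.TTheory GRing.Theory Num.Theory.
Local Open Scope classical_set_scope.
Local Open Scope ring_scope.

(** The walk stays close to the origin because its position is described by few
    letters, while most elements with a short description are out of reach of a
    symmetric walk unless they have small word length.

    An element of the group is determined by its sections at the [2 ^ d] vertices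
    of level [d] together with one bit for each vertex above. Along the walk, the
    section at a first-level vertex is again a random walk on the group: a step of
    [b] type leaves the vertex and comes back at the next step of [b] type, and the
    letters written on the way out and on the way back cancel, or neither step
    writes one, half of the time. Two levels down one finds the original walk
    again, run for about an eighth of the time. With [8 ^ J] of order [n], the [4 ^ J] sections at level [2 J] have
    bounded mean length, so the mean total section length is of order [n^(2/3)]
    ([mean_section_len]). To make this rigorous, the walk is killed at rate of
    order [1 / n]; killing makes the induced walks exact, and it turns the estimate
    into the existence of a supersolution ([has_potential]) that is built level by
    level from one below ([potential_step], [potential_iter]).

    The number of elements with total section length at most [t] at level [2 J] is
    exponential in [t + 4 ^ J] ([section_count]). By the Varopoulos-Carne bound
    ([carne]), a symmetric walk is at a given element of word length at least [x]
    with probability at most [2 exp (- x^2 / (8 n))]. At [x = lambda n^(5/6)] this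
    exponent is of order [lambda^2 n^(2/3)] and beats the number of candidates, of
    logarithm [lambda n^(2/3)]; the remaining event, a total section length above
    a multiple of [lambda n^(2/3)], has probability of order [1 / lambda] by Markov's
    inequality ([tail_bound]). Ottaviani's inequality ([hit_prob_le]) passes from a
    fixed time to the maximum.

    All estimates concern the transition operator [markov] acting on functions on
    the group; [cylinder_exceeds_prob] transfers them to the probability space. *)

(** * Words in the generators *)

Section Letters.
Local Open Scope group_scope.

(** The first component tells [b] from [a], the second marks inverses. *)
Definition letter := (bool * bool)%type.

Definition gen (l : letter) : basilica :=
  let g := if l.1 then gen_b else gen_a in if l.2 then g^-1 else g.

Definition inv_letter (l : letter) : letter := (l.1, ~~ l.2).

Lemma gen_inv l : gen (inv_letter l) = (gen l)^-1.
Proof. by case: l => [[] []]; rewrite /gen /= ?invgK. Qed.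

Definition word_value (w : seq letter) : basilica := \prod_(l <- w) gen l.

Lemma word_value_cat u w : word_value (u ++ w) = word_value u * word_value w.
Proof. by rewrite /word_value big_cat. Qed.

Lemma word_value_seq1 l : word_value [:: l] = gen l.
Proof. by rewrite /word_value big_seq1. Qed.

Lemma word_value_inv w : word_value (rev (map inv_letter w)) = (word_value w)^-1.
Proof.
elim: w => [|l w IH]; first by rewrite /word_value big_nil invg1.
rewrite map_cons rev_cons -cats1 word_value_cat IH word_value_seq1 gen_inv.
by rewrite -[l :: w]cat1s word_value_cat word_value_seq1 invgM.
Qed.

Definition wlen (g : basilica) : nat := word_length [set gen_a; gen_b] g.

Lemma is_word_value (g : basilica) n :
  is_word [set gen_a; gen_b] g n <-> exists2 w, size w = n & word_value w = g.
Proof.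
split=> [[s [<- + ->]]|[w <- <-]].
  elim: s => [|x s IH] sS; first by exists [::]; rewrite // /word_value !big_nil.
  have [|w ws wE] := IH; first by move=> y ys; apply: sS; rewrite inE ys orbT.
  have [l lx] : exists l, gen l = x.
    case: (sS x (mem_head _ _)) => -[] h.
    - by exists (false, false).
    - by exists (true, false).
    - by exists (false, true); rewrite /gen /= -h invgK.
    - by exists (true, true); rewrite /gen /= -h invgK.
  exists (l :: w); first by rewrite /= ws.
  by rewrite -cat1s word_value_cat word_value_seq1 wE lx big_cons.
exists (map gen w); split; rewrite ?size_map ?big_map // => x /mapP[[[] []] _ ->];
  rewrite /gen /=.
- by right; rewrite invgK; right.
- by left; right.
- by right; rewrite invgK; left.
- by left; left.
Qed.

Lemma wlen_le w : (wlen (word_value w) <= size w)%N.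
Proof.
rewrite /wlen /word_length; case: pselect => [e|[]]; last first.
  by exists (size w); apply/asboolP/is_word_value; exists w.
by case: ex_minnP => m _; apply; apply/asboolP/is_word_value; exists w.
Qed.

Lemma wlen_word g : exists2 w, word_value w = g & size w = wlen g.
Proof.
rewrite /wlen /word_length; case: pselect => [e|[]]; last first.
  by have [n gn] := basilica_is_word g; exists n; apply/asboolP.
by case: ex_minnP => m /asboolP/is_word_value[w wm wg] _; exists w.
Qed.

Lemma wlen1 : wlen 1 = 0%N.
Proof.
by have := wlen_le [::]; rewrite /word_value big_nil leqn0 => /eqP.
Qed.

Lemma wlenM g h : (wlen (g * h)%g <= wlen g + wlen h)%N.
Proof.
have [u <- <-] := wlen_word g; have [w <- <-] := wlen_word h.
by rewrite -word_value_cat -size_cat wlen_le.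
Qed.

Lemma wlen_gen l : (wlen (gen l) <= 1)%N.
Proof. by rewrite -word_value_seq1 wlen_le. Qed.

Lemma wlenV_le g : (wlen g^-1%g <= wlen g)%N.
Proof.
have [u <- <-] := wlen_word g.
by rewrite -word_value_inv (leq_trans (wlen_le _)) // size_rev size_map.
Qed.

Lemma wlenV g : wlen g^-1 = wlen g.
Proof.
by apply/eqP; rewrite eqn_leq wlenV_le -{1}[g]invgK wlenV_le.
Qed.

Lemma word_value_surj g : exists w, word_value w = g.
Proof. by have [w] := wlen_word g; exists w. Qed.

End Letters.

(** * Sections of automorphisms at the two vertices of the first level *)

Section Sections.
Local Open Scope group_scope.

(** The permutation that [g] induces on the first level. *)
Definition act (g : tree_aut) (i : bool) : bool := head false (g [:: i]).

Definition section_fun (g : tree_aut) (i : bool) (v : vertex) : vertex :=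
  behead (g (i :: v)).

(** Edges go to edges, so a child of [u] goes to a child of [g u]; this makes
    an automorphism act letter by letter and lets it be cut into sections. *)
Lemma aut_rcons (g : tree_aut) u x : exists y, g (rcons u x) = rcons (g u) y.
Proof. by have [|y] := (tree_aut_edge g u (rcons u x)).1; [exists x|exists y]. Qed.

Lemma aut_cons (g : tree_aut) i v : g (i :: v) = act g i :: section_fun g i v.
Proof.
rewrite /act /section_fun; elim/last_ind: v => [|v x IH].
  by have [y] := aut_rcons g [::] i; rewrite tree_aut_root /= => ->.
by have [y] := aut_rcons g (i :: v) x; rewrite rcons_cons => ->; rewrite IH.
Qed.

Lemma actM (g h : tree_aut) i : act (g * h) i = act h (act g i).
Proof. by rewrite {1}/act tree_aut_mulE !aut_cons. Qed.

Lemma act1 i : act 1 i = i.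
Proof. by []. Qed.

Lemma section_funM (g h : tree_aut) i v :
  section_fun (g * h) i v = section_fun h (act g i) (section_fun g i v).
Proof. by rewrite {1}/section_fun tree_aut_mulE !aut_cons. Qed.

Lemma section_fun1 i v : section_fun 1 i v = v.
Proof. by []. Qed.

Lemma actK (g : tree_aut) i : act g^-1 (act g i) = i.
Proof. by rewrite -actM mulgV act1. Qed.

Fact section_subproof (g : tree_aut) i : section_fun g i \in tree_automorphism.
Proof.
have edge (h : tree_aut) j u v :
    tree_edge u v -> tree_edge (section_fun h j u) (section_fun h j v).
  case=> x ->; have [y] := aut_rcons h (j :: u) x.
  by rewrite rcons_cons !aut_cons rcons_cons => -[->]; exists y.
apply: (@tree_automorphism_children _ (section_fun g^-1 (act g i))) => [v|v||];
  try exact: edge.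
- by rewrite -section_funM mulgV section_fun1.
- have := section_funM g^-1 g (act g i) v.
  by rewrite actK => <-; rewrite mulVg section_fun1.
Qed.

Definition section_aut (g : tree_aut) i : tree_aut := TreeAut (section_subproof g i).

Lemma section_autM (g h : tree_aut) i :
  section_aut (g * h) i = section_aut g i * section_aut h (act g i).
Proof. by apply: tree_aut_eq => v; rewrite /= section_funM. Qed.

Lemma section_aut1 i : section_aut 1 i = 1.
Proof. by apply: tree_aut_eq => v. Qed.

Lemma section_autV (g : tree_aut) i :
  section_aut g^-1 i = (section_aut g (act g^-1 i))^-1.
Proof.
apply/eqP; rewrite -mulg_eq1 -section_autM mulVg section_aut1 //.
Qed.

(** The elements of [ab_group] whose sections stay in [ab_group] form a
    subgroup, by the cocycle rule [section_autM], and it contains [a] and [b]. *)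
Lemma section_in (g : basilica) i : section_aut g i \in ab_group.
Proof.
have := basilica_valP g; rewrite inE; move: i.
have cl := ab_group_closed.
suff: ab_group `<=` [set h | forall i, section_aut h i \in ab_group].
  by move=> + i gG => /(_ _ gG).
apply: smallest_sub.
  split=> [|x y]; rewrite !inE => xG.
    by rewrite section_aut1; case: cl.
  move=> yG i; rewrite section_autM section_autV.
  by case: cl => _; apply; [apply: xG|apply: yG].
have a1 : section_aut aut_a false = 1 by apply: tree_aut_eq.
have a2 : section_aut aut_a true = aut_b by apply: tree_aut_eq.
have b1 : section_aut aut_b false = 1 by apply: tree_aut_eq.
have b2 : section_aut aut_b true = aut_a by apply: tree_aut_eq.
by move=> _ [] -> []; rewrite ?a1 ?a2 ?b1 ?b2 ?aut_a_in ?aut_b_in //; case: cl.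
Qed.

(** [sec] and [bact] are [section_aut] and [act] on the group itself: with
    [sec_inj] they embed it in the wreath product. *)
Definition sec (g : basilica) i : basilica := Basilica (section_in g i).
Definition bact (g : basilica) i : bool := act g i.

Lemma secM (g h : basilica) i : sec (g * h) i = sec g i * sec h (bact g i).
Proof. by apply: val_inj; exact: section_autM. Qed.

Lemma bactM (g h : basilica) i : bact (g * h) i = bact h (bact g i).
Proof. exact: actM. Qed.

Lemma bact_neg (g : basilica) i : bact g (~~ i) = ~~ bact g i.
Proof.
have := can_inj (actK g) (x1 := ~~ i) (x2 := i); rewrite /bact.
by case: (act g (~~ i)); case: (act g i) => //; case: i => // /(_ erefl).
Qed.

Lemma sec_inj (g h : basilica) :
  (forall i, sec g i = sec h i) -> bact g false = bact h false -> g = h.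
Proof.
move=> gh bgh; apply/val_inj/tree_aut_eq => -[|i v]; first by rewrite !tree_aut_root.
have b : bact g i = bact h i.
  by case: i => //; rewrite -[true]/(~~ false) !bact_neg bgh.
rewrite !aut_cons -[act _ _]/(bact g i) b; congr cons.
by have /(congr1 val)/(congr1 (fun f : tree_aut => f v)) := gh i.
Qed.

(** A section of a generator is trivial or a generator, and at most one of the
    two sections is nontrivial. The walk therefore induces walks on the group at
    the two vertices: standing at [true], a step [a^+-1] writes the letter
    [b^+-1], while a step [b^+-1] moves to [false] and writes [a] or nothing. *)
Lemma sec_gen l i : sec (gen l) i =
  match l, i with
  | (false, s), true => gen (true, s)
  | (true, false), true => gen (false, false)
  | (true, true), false => gen (false, true)
  | _, _ => 1
  end.
Proof.
have a1 : sec gen_a false = 1 by apply/val_inj/tree_aut_eq.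
have a2 : sec gen_a true = gen_b by apply/val_inj/tree_aut_eq.
have b1 : sec gen_b false = 1 by apply/val_inj/tree_aut_eq.
have b2 : sec gen_b true = gen_a by apply/val_inj/tree_aut_eq.
have secV (g : basilica) j : sec g^-1 (bact g j) = (sec g j)^-1.
  apply: (mulgI (sec g j)); rewrite -secM !mulgV.
  by apply/val_inj/tree_aut_eq.
case: l => [[] []]; rewrite /gen /=.
- case: i.
    by rewrite -[true]/(bact gen_b false) secV b1 invg1.
  by rewrite -[false]/(bact gen_b true) secV b2.
- by case: i; rewrite ?b1 ?b2.
- case: i.
    by rewrite -[true]/(bact gen_a true) secV a2.
  by rewrite -[false]/(bact gen_a false) secV a1 invg1.
- by case: i; rewrite ?a1 ?a2.
Qed.

Lemma bact_gen l i : bact (gen l) i = l.1 (+) i.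
Proof.
have bactV (g : basilica) j : bact g^-1 (bact g j) = j.
  by rewrite -bactM mulgV.
case: l => [[] []]; case: i => //; rewrite /gen.
- by rewrite -[true]/(bact gen_b false) bactV.
- by rewrite -[false]/(bact gen_b true) bactV.
- by rewrite -[true]/(bact gen_a true) bactV.
- by rewrite -[false]/(bact gen_a false) bactV.
Qed.

End Sections.

(** * Total length of the sections at a level *)

Section SectionLength.

Fixpoint section_len (d : nat) (g : basilica) : nat :=
  if d is d'.+1 then section_len d' (sec g false) + section_len d' (sec g true)
  else wlen g.

Lemma sec1 i : sec 1%g i = 1%g.
Proof. by apply/val_inj/tree_aut_eq. Qed.

Lemma section_len1 d : section_len d 1%g = 0%N.
Proof. by elim: d => [|d IH]; rewrite /= ?wlen1 ?sec1 ?IH. Qed.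

(** The sections of [g * h] are those of [g] times those of [h] permuted by the
    action of [g]; a sum over the whole level does not see the permutation. *)
Lemma section_lenM d g h :
  (section_len d (g * h)%g <= section_len d g + section_len d h)%N.
Proof.
elim: d g h => [|d IH] g h /=; first exact: wlenM.
have -> : (section_len d (sec h false) + section_len d (sec h true) =
    section_len d (sec h (bact g false)) + section_len d (sec h (bact g true)))%N.
  rewrite -[true in RHS]/(~~ false) bact_neg; case: (bact g false) => //=.
  by rewrite addnC.
by rewrite !secM addnACA leq_add.
Qed.

Lemma section_len_gen d l : (section_len d (gen l) <= 1)%N.
Proof.
elim: d l => [|d IH] l /=; first exact: wlen_gen.
by rewrite !sec_gen; case: l => [[] []]; rewrite ?section_len1 ?addn0 ?add0n ?IH.
Qed.

End SectionLength.

(** * Potentials and the renormalization of the killed walk *)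

Section Supersolution.
Variable R : realType.
Implicit Types (f v : basilica -> R) (k A B X : R) (g h : basilica).

Definition nbr_sum f (c : bool) (g : basilica) : R :=
  f (g * gen (c, false))%g + f (g * gen (c, true))%g.

(** A supersolution for the walk with weights [A] and [B] on the steps [a^+-1] and
    [b^+-1] that is killed at rate [k]. Such a [v] dominates the Green function of
    this killed walk applied to [section_len d], so [X] bounds the mean of
    [section_len d] at the killing time of the walk started at [1]. A pointwise
    inequality takes the place of infinite sums over trajectories. *)
Definition has_potential (d : nat) k A B X : Prop :=
  exists v : basilica -> R, [/\ forall g, 0 <= v g,
    forall g, (section_len d g)%:R <=
      (k + A + B) * v g - A / 2 * nbr_sum v false g - B / 2 * nbr_sum v true g &
    forall g, v g <= ((section_len d g)%:R + X) / k].

Lemma potential_le d k A B X Y : 0 < k -> X <= Y ->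
  has_potential d k A B X -> has_potential d k A B Y.
Proof.
move=> k0 XY [v [v0 vS vX]]; exists v; split=> // g.
by rewrite (le_trans (vX g)) // ler_pM2r ?invr_gt0 // lerD2l.
Qed.

(** Only the ratios of the rates matter. *)
Lemma potential_scale d c k A B X : 0 < c ->
  has_potential d (c * k) (c * A) (c * B) X -> has_potential d k A B X.
Proof.
move=> c0 [v [v0 vS vX]]; exists (fun g => c * v g); split=> g.
- by rewrite mulr_ge0 // ltW.
- by rewrite (le_trans (vS g)) // /nbr_sum le_eqVlt; apply/orP; left; apply/eqP; ring.
- rewrite (le_trans (ler_wpM2l (ltW c0) (vX g))) //.
  have [->|k0] := eqVneq k 0; first by rewrite mulr0 invr0 !mulr0.
  by rewrite le_eqVlt; apply/orP; left; apply/eqP; field; rewrite k0 gt_eqF.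
Qed.

(** At level [0] the total section length is the word length, which each step
    increases by at most one; the constant [(A + B) / k] is the mean number of
    steps before killing. *)
Lemma potential0 k A B : 0 < k -> 0 <= A -> 0 <= B ->
  has_potential 0 k A B ((A + B) / k).
Proof.
move=> k0 A0 B0; exists (fun g => ((wlen g)%:R + (A + B) / k) / k); split=> //= g.
  by rewrite divr_ge0 ?addr_ge0 ?divr_ge0 ?addr_ge0 ?ler0n // ltW.
have step l : ((wlen (g * gen l)%g)%:R : R) <= (wlen g)%:R + 1.
  by rewrite natr1 ler_nat -addn1 (leq_trans (wlenM _ _)) // leq_add2l wlen_gen.
rewrite /nbr_sum; set N := (wlen g)%:R.
have nb c : ((wlen (g * gen (c, false))%g)%:R + (A + B) / k) / k +
   ((wlen (g * gen (c, true))%g)%:R + (A + B) / k) / k <=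
   2 * (N + 1 + (A + B) / k) / k.
  rewrite -mulrDl ler_pM2r ?invr_gt0 //.
  have := step (c, false); have := step (c, true); rewrite -/N; lra.
have h1 := ler_wpM2l (divr_ge0 A0 (ler0n R 2)) (nb false).
have h2 := ler_wpM2l (divr_ge0 B0 (ler0n R 2)) (nb true).
apply: le_trans (lerB (lerB (lexx _) h1) h2).
rewrite le_eqVlt; apply/orP; left; apply/eqP; field.
by rewrite gt_eqF.
Qed.

(** The supersolution inequality at the first-level vertex [true]. Eliminating
    the excursions to [false], where the walk waits until its next [b^+-1], leaves
    a walk that writes [b^+-1] with the old weight [A] of [a^+-1], and [a^+-1] when
    exactly one of the step to [false] and the step back writes a letter; hence
    the weights [A'] and [A]. The shift by [eta] pays for [la <= l + 1]. Here [l],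
    [la] are section lengths and [x], [xa], [xA], [xb], [xB] the values of the
    level below at an element and at its four neighbours. *)
Lemma potential_step_ineq k A B l la x xa xA xb xB :
  let k' := k * (k + 2 * B) / (k + B) in
  let A' := B ^+ 2 / (2 * (k + B)) in
  let kap := (k + 2 * B) / (k + B) in
  let eta := B / (2 * (k + 2 * B)) in
  let u y := kap * (y + eta / k') in
  0 < k -> 0 < B -> la <= l + 1 ->
  l <= (k' + A' + A) * x - A' / 2 * (xa + xA) - A / 2 * (xb + xB) ->
  l <= (k + A + B) * u x - A / 2 * (u xb + u xB)
       - B / 2 * ((la + B / 2 * (u xa + u x)) / (k + B)
                  + (l + B / 2 * (u x + u xA)) / (k + B)).
Proof.
move=> k' A' kap eta u k0 B0 lal h.
have kB : 0 < k + B by lra.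
have kB2 : 0 < k + 2 * B by lra.
rewrite -subr_ge0.
have -> : (k + A + B) * u x - A / 2 * (u xb + u xB)
       - B / 2 * ((la + B / 2 * (u xa + u x)) / (k + B)
                  + (l + B / 2 * (u x + u xA)) / (k + B)) - l =
    kap * ((k' + A' + A) * x - A' / 2 * (xa + xA) - A / 2 * (xb + xB) - l)
    + B / (2 * (k + B)) * (l + 1 - la).
  rewrite /u /kap /eta /k' /A'; field.
  by rewrite !gt_eqF.
have c0 : 0 <= kap by rewrite divr_ge0 ?ltW.
have c1 : 0 <= B / (2 * (k + B)) by rewrite divr_ge0 ?mulr_ge0 ?ltW.
by apply: addr_ge0; apply: mulr_ge0; rewrite ?subr_ge0.
Qed.

(** The potential one level up: [u1] and [u0] are the potentials seen from the
    vertices [true] and [false] of the first level, built from the potential [v]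
    of the induced walk, and the two sections contribute one term each. Up to a
    constant both vertices carry the same mean, whence the factor [2]. *)
Lemma potential_step d k A B X : 0 < k -> 0 <= A -> 0 < B -> 0 <= X ->
  has_potential d (k * (k + 2 * B) / (k + B)) (B ^+ 2 / (2 * (k + B))) A X ->
  has_potential d.+1 k A B (2 * X + 1).
Proof.
move=> k0 A0 B0 X0; set k' := k * _ / _; set A' := B ^+ 2 / _.
have kB : 0 < k + B by lra.
have kB2 : 0 < k + 2 * B by lra.
have k'0 : 0 < k' by rewrite /k' divr_gt0 ?mulr_gt0.
move=> [v [v0 vS vX]].
pose kap := (k + 2 * B) / (k + B); pose eta := B / (2 * (k + 2 * B)).
pose u1 h := kap * (v h + eta / k').
pose u0 h :=
  ((section_len d h)%:R + B / 2 * (u1 h + u1 (h * gen (false, true))%g)) / (k + B).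
pose u h (p : bool) := if p then u1 h else u0 h.
have kap0 : 0 < kap by rewrite divr_gt0.
have eta0 : 0 <= eta by rewrite divr_ge0 ?mulr_ge0 // ltW.
have u10 h : 0 <= u1 h.
  apply: mulr_ge0; first exact: ltW.
  by apply: addr_ge0 => //; apply: divr_ge0 => //; exact: ltW.
have u00 h : 0 <= u0 h.
  apply: divr_ge0; last exact: ltW.
  apply: addr_ge0; rewrite ?ler0n //; apply: mulr_ge0; first lra.
  exact: addr_ge0.
have uge0 h p : 0 <= u h p by rewrite /u; case: p.
have Lgen h l : ((section_len d (h * gen l)%g)%:R : R) <= (section_len d h)%:R + 1.
  rewrite natr1 ler_nat -addn1 (leq_trans (section_lenM _ _ _)) //.
  by rewrite leq_add2l section_len_gen.
have u1X h : u1 h <= ((section_len d h)%:R + X + 1 / 4) / k.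
  have e4 : eta <= 1 / 4.
    by rewrite /eta ler_pdivrMr ?mulr_gt0 //; lra.
  have -> : ((section_len d h)%:R + X + 1 / 4) / k =
      kap * (((section_len d h)%:R + X) / k' + (1 / 4) / k').
    by rewrite /kap /k'; field; rewrite !gt_eqF.
  by rewrite ler_pM2l // lerD // ler_pM2r ?invr_gt0.
have u0X h : u0 h <= ((section_len d h)%:R + X + 3 / 4) / k.
  rewrite /u0 ler_pdivrMr //.
  have h1 := u1X h; have h2 := u1X (h * gen (false, true))%g.
  have h3 := Lgen h (false, true).
  set N := (section_len d h)%:R in h1 h3 *.
  set N' := (section_len d _)%:R in h2 h3.
  have h2' : u1 (h * gen (false, true))%g <= (N + X + 1 + 1 / 4) / k.
    by apply: le_trans h2 _; rewrite ler_pM2r ?invr_gt0 //; lra.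
  have B2 : 0 <= B / 2 by lra.
  apply: le_trans (lerD (lexx N) (ler_wpM2l B2 (lerD h1 h2'))) _.
  rewrite -subr_ge0.
  have -> : (N + X + 3 / 4) / k * (k + B) -
     (N + B / 2 * ((N + X + 1 / 4) / k + (N + X + 1 + 1 / 4) / k)) = X + 3 / 4.
    by field; rewrite gt_eqF.
  lra.
have uX h p : u h p <=
    ((section_len d h)%:R + X + p%:R * (1/4) + (~~ p)%:R * (3/4)) / k.
  by case: p; rewrite /= mul0r mul1r ?addr0.
have uS h p : (section_len d h)%:R <= (k + A + B) * u h p
   - A / 2 * (u (h * sec (gen (false, false)) p)%g p
              + u (h * sec (gen (false, true)) p)%g p)
   - B / 2 * (u (h * sec (gen (true, false)) p)%g (~~ p)
              + u (h * sec (gen (true, true)) p)%g (~~ p)).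
  case: p; rewrite !sec_gen ?mulg1 /=.
    (* The cancellation [a a^-1 = 1] that makes the induced walk shorter. *)
    have aA : (h * gen (false, false) * gen (false, true))%g = h.
      by rewrite -mulgA /gen /= mulgV mulg1.
    rewrite /u0 aA; apply: potential_step_ineq => //; exact: vS.
  rewrite le_eqVlt; apply/orP; left; apply/eqP.
  by rewrite /u0; field; rewrite gt_eqF.
exists (fun g => u (sec g false) (bact g false) + u (sec g true) (bact g true)).
split=> g.
- by rewrite addr_ge0.
- rewrite /nbr_sum !secM !bactM !bact_gen /=.
  have h1 := uS (sec g false) (bact g false).
  have h2 := uS (sec g true) (bact g true).
  rewrite natrD; apply: le_trans (lerD h1 h2) _.
  by rewrite le_eqVlt; apply/orP; left; apply/eqP; ring.
- have h1 := uX (sec g false) (bact g false).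
  have h2 := uX (sec g true) (bact g true).
  apply: le_trans (lerD h1 h2) _.
  rewrite -mulrDl ler_pM2r ?invr_gt0 // /= natrD.
  rewrite -[true]/(~~ false) bact_neg.
  case: (bact g false) => /=; lra.
Qed.

End Supersolution.

Section Renormalization.
Variable R : realType.
Implicit Types (f v : basilica -> R) (k A B X : R) (g h : basilica).

(** Two levels down the roles of [a] and [b] are restored. After rescaling by [2]
    the weights change by terms of order [k] only, and the killing rate is
    multiplied by nearly [2 * 2 * 2 = 8]: every section two levels down receives
    about an eighth of the steps. *)
Lemma potential_two_steps d k A B X : 0 < k -> 0 < A -> 0 < B -> 0 <= X ->
  let k1 := k * (k + 2 * B) / (k + B) in
  has_potential d (2 * (k1 * (k1 + 2 * A) / (k1 + A))) (A ^+ 2 / (k1 + A))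
    (B ^+ 2 / (k + B)) X ->
  has_potential d.+2 k A B (4 * X + 3).
Proof.
move=> k0 A0 B0 X0 k1 h.
have k10 : 0 < k1 by rewrite /k1 divr_gt0 ?mulr_gt0 ?addr_gt0 ?mulr_gt0.
have -> : 4 * X + 3 = 2 * (2 * X + 1) + 1 by ring.
apply: potential_step => //; first exact: ltW.
  by rewrite addr_ge0 ?mulr_ge0.
apply: potential_step => //.
  by rewrite divr_ge0 ?sqr_ge0 ?mulr_ge0 ?addr_ge0 // ltW.
apply: (@potential_scale _ _ 2) => //.
suff [-> ->] : 2 * (A ^+ 2 / (2 * (k1 + A))) = A ^+ 2 / (k1 + A) /\
    2 * (B ^+ 2 / (2 * (k + B))) = B ^+ 2 / (k + B) by [].
by split; field; rewrite gt_eqF // addr_gt0.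
Qed.

(** The new killing rate is twice the harmonic mean of [k] and [k + 2 * B], so
    its inverse is the average of two inverses; this turns the renormalization of
    [k^-1] into an affine recursion with bounded error. *)
Lemma harmonic_step k B mu : 0 < k -> 0 < mu -> mu <= B ->
  let k1 := k * (k + 2 * B) / (k + B) in
  [/\ 0 < k1, k1 <= 2 * k & k1^-1 <= k^-1 / 2 + mu^-1 / 4].
Proof.
move=> k0 mu0 muB k1; have B0 : 0 < B by lra.
have kB : 0 < k + B by lra.
have kB2 : 0 < k + 2 * B by lra.
split; first by rewrite /k1 divr_gt0 ?mulr_gt0.
  rewrite /k1 ler_pdivrMr // -subr_ge0.
  have -> : 2 * k * (k + B) - k * (k + 2 * B) = k * k by ring.
  by rewrite mulr_ge0 ?ltW.
have -> : k1^-1 = k^-1 / 2 + (k + 2 * B)^-1 / 2.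
  by rewrite /k1; field; rewrite !gt_eqF.
rewrite lerD2l.
have : (k + 2 * B)^-1 <= (2 * mu)^-1 by rewrite lef_pV2 ?posrE ?mulr_gt0 //; lra.
by rewrite invfM; lra.
Qed.

(** Over [J] double levels [k^-1] is divided by [8 ^+ J] up to an additive error
    of order [mu^-1], while the number of sections grows by [4 ^+ J] only. The
    lower bounds on [A] and [B] keep the weights above [mu] along the whole
    iteration, since a double level lowers them by at most [2 * k] and multiplies
    [k] by at most [8]. *)
Lemma potential_iter mu J k A B : 0 < mu -> 0 < k ->
  mu + (8 ^+ J - 1) * k <= A -> mu + (8 ^+ J - 1) * k <= B ->
  has_potential J.*2 k A B
    (4 ^+ J * ((A + B) * ((8 ^+ J)^-1 / k + (1 - (8 ^+ J)^-1) / mu) + 1) - 1).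
Proof.
move=> mu0; elim: J k A B => [|J IH] k A B k0.
  rewrite !expr0 subrr mul0r addr0 invr1 subrr mul0r addr0 !mul1r addrK => muA muB.
  by apply: potential0 => //; lra.
set E : R := 8 ^+ J; set F : R := 4 ^+ J.
have E1 : 1 <= E by rewrite exprn_ege1 //; lra.
have F1 : 1 <= F by rewrite exprn_ege1 //; lra.
rewrite !exprS -/E -/F => hA hB.
have Ek : k <= E * k by rewrite ler_peMl // ltW.
have muA : mu <= A by nra.
have muB : mu <= B by nra.
have A0 : 0 < A by lra.
have B0 : 0 < B by lra.
have [k10 k1k ik1] := harmonic_step k0 mu0 muB.
set k1 := k * (k + 2 * B) / (k + B) in k10 k1k ik1.
have [k20 k2k ik2] := harmonic_step k10 mu0 muA.
set k2 := k1 * (k1 + 2 * A) / (k1 + A) in k20 k2k ik2.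
pose A' := A ^+ 2 / (k1 + A); pose B' := B ^+ 2 / (k + B).
have A'A : A' <= A by rewrite ler_pdivrMr ?addr_gt0 //; nra.
have B'B : B' <= B by rewrite ler_pdivrMr ?addr_gt0 //; nra.
have A'l : A - 2 * k <= A'.
  apply: (@le_trans _ _ (A - k1)); first by lra.
  by rewrite ler_pdivlMr ?addr_gt0 //; nra.
have B'l : B - k <= B' by rewrite ler_pdivlMr ?addr_gt0 //; nra.
have k2k8 : 2 * k2 <= 8 * k by lra.
have Ek2 : (E - 1) * (2 * k2) <= (E - 1) * (8 * k) by rewrite ler_wpM2l //; lra.
have := IH (2 * k2) A' B'; rewrite -/E -/F.
set X := (X in has_potential _ _ _ _ X) => IH'.
have E'0 : 0 < E^-1 by rewrite invr_gt0; lra.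
have E'1 : E^-1 <= 1 by rewrite invf_le1 //; lra.
have A'0 : 0 <= A' by rewrite divr_ge0 ?sqr_ge0 // ltW // addr_gt0.
have B'0 : 0 <= B' by rewrite divr_ge0 ?sqr_ge0 // ltW // addr_gt0.
have k22 : 0 < 2 * k2 by rewrite mulr_gt0.
have X0 : 0 <= X.
  rewrite /X subr_ge0 mulr_ege1 // lerDr mulr_ge0 ?addr_ge0 //.
    by rewrite divr_ge0 // ltW.
  by rewrite divr_ge0 ?subr_ge0 // ltW.
apply: (@potential_le _ _ _ _ _ (4 * X + 3)) => //; last first.
  by apply: (potential_two_steps k0 A0 B0 X0); apply: IH' => //; lra.
have key : E^-1 / (2 * k2) + (1 - E^-1) / mu <=
    (8 * E)^-1 / k + (1 - (8 * E)^-1) / mu.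
  have i2 : (2 * k2)^-1 <= k^-1 / 8 + mu^-1 * (3 / 16).
    by rewrite invfM; lra.
  have mui : 0 < mu^-1 by rewrite invr_gt0.
  rewrite invfM.
  have := ler_wpM2l (ltW E'0) i2.
  have : 0 < E^-1 * mu^-1 by rewrite mulr_gt0.
  lra.
have pos : 0 <= E^-1 / (2 * k2) + (1 - E^-1) / mu.
  by rewrite addr_ge0 // divr_ge0 ?subr_ge0 // ltW.
have := ler_pM (addr_ge0 A'0 B'0) pos (lerD A'A B'B) key.
rewrite /X; set P := _ * _; set Q := _ * _ => PQ.
by have := ler_wpM2l (le_trans ler01 F1) PQ; lra.
Qed.

End Renormalization.

(** * The transition operator and the mean total section length *)

Section Markov.
Variables (R : realType) (r : R).
Hypothesis r_gt0 : 0 < r.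
Implicit Types (f : basilica -> R) (g h : basilica).

Definition step_weight (l : letter) : R := (if l.1 then r else 1) / (2 + 2 * r).

(** [iter n markov f g] is the expectation of [f] at time [n] for the walk started
    at [g]. *)
Definition markov f (g : basilica) : R :=
  \sum_(l : letter) step_weight l * f (g * gen l)%g.

Local Notation P n := (iter n markov).

Lemma sum_letter (F : letter -> R) :
  \sum_l F l = F (true, true) + F (true, false) + (F (false, true) + F (false, false)).
Proof.
rewrite (eq_bigr (fun l => F (l.1, l.2))); last by case.
by rewrite -(pair_bigA _ (fun i j => F (i, j))) /= !big_bool.
Qed.

Lemma step_weight_ge0 l : 0 <= step_weight l.
Proof.
rewrite divr_ge0 ?addr_ge0 ?mulr_ge0 // ?ltW //.
by case: ifP => _ //; rewrite ltW.
Qed.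

Lemma step_weight_sum : \sum_l step_weight l = 1.
Proof.
rewrite sum_letter /step_weight /=; field.
by rewrite gt_eqF // addr_gt0 ?mulr_gt0.
Qed.

Lemma markovE f g :
  (1 + r) * markov f g = 1 / 2 * nbr_sum f false g + r / 2 * nbr_sum f true g.
Proof.
rewrite /markov sum_letter /step_weight /nbr_sum /=; field.
by rewrite gt_eqF // addr_gt0 ?mulr_gt0.
Qed.

Lemma markov_le_ball n f f' g :
  (forall h, (wlen h <= wlen g + n)%N -> f h <= f' h) -> P n f g <= P n f' g.
Proof.
elim: n g => [|n IH] g ff' /=; first by rewrite ff' ?addn0.
apply: ler_sum => l _; rewrite ler_wpM2l ?step_weight_ge0 // IH // => h hg.
rewrite ff' // (leq_trans hg) // addnS -addSn leq_add2r -addn1.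
by rewrite (leq_trans (wlenM _ _)) // leq_add2l wlen_gen.
Qed.

Lemma markov_le n f f' g : (forall h, f h <= f' h) -> P n f g <= P n f' g.
Proof. by move=> ff'; apply: markov_le_ball => h _; exact: ff'. Qed.

Lemma markov_ge0 n f g : (forall h, 0 <= f h) -> 0 <= P n f g.
Proof.
move=> f0; elim: n g => [|n IH] g //=.
by apply: sumr_ge0 => l _; rewrite mulr_ge0 ?step_weight_ge0.
Qed.

Lemma markov_cst n c g : P n (fun=> c) g = c.
Proof.
elim: n g => [|n IH] g //=; rewrite /markov.
by under eq_bigr do rewrite IH; rewrite -mulr_suml step_weight_sum mul1r.
Qed.

Lemma markovZ n c f g : P n (fun h => c * f h) g = c * P n f g.
Proof.
elim: n g => [|n IH] g //=; rewrite /markov.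
by under eq_bigr do rewrite IH mulrCA; rewrite -mulr_sumr.
Qed.

Lemma markovD n f f' g : P n (fun h => f h + f' h) g = P n f g + P n f' g.
Proof.
elim: n g => [|n IH] g //=; rewrite /markov.
by under eq_bigr do rewrite IH mulrDr; rewrite big_split.
Qed.

Lemma markov_sum (I : Type) (s : seq I) n (f : I -> basilica -> R) g :
  P n (fun h => \sum_(i <- s) f i h) g = \sum_(i <- s) P n (f i) g.
Proof.
elim: n g => [|n IH] g //=; rewrite /markov exchange_big /=.
by apply: eq_bigr => l _; rewrite IH mulr_sumr.
Qed.

Lemma markov_translate n f g h : P n (fun x => f (g * x)%g) h = P n f (g * h)%g.
Proof.
elim: n h => [|n IH] h //=; rewrite /markov.
by apply: eq_bigr => l _; rewrite IH mulgA.
Qed.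

(** Stop after [m] steps; the increments after time [m] form a walk started
    at [1]. *)
Lemma markov_subadditive (f : basilica -> R) m n :
  (forall g h, f (g * h)%g <= f g + f h) ->
  P (m + n) f 1%g <= P m f 1%g + P n f 1%g.
Proof.
move=> fM; rewrite iterD -[X in _ + X](markov_cst m _ 1%g) -markovD.
apply: markov_le => g; rewrite -[g in X in X <= _]mulg1 -markov_translate.
by rewrite -[f g](markov_cst n _ 1%g) -markovD; apply: markov_le.
Qed.

(** Iterating the supersolution inequality: [(1 + r) / (k + (1 + r))] is the
    probability of surviving one step. *)
Lemma potential_sum (f v : basilica -> R) (k : R) n g : 0 < k ->
  (forall g, 0 <= v g) ->
  (forall g, f g <= (k + (1 + r)) * v g - (1 + r) * markov v g) ->
  \sum_(m < n) ((1 + r) / (k + (1 + r))) ^+ m * P m f g <= (k + (1 + r)) * v g.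
Proof.
move=> k0 v0 fv; set a := 1 + r in fv *; set T := k + a in fv *.
have a0 : 0 < a by rewrite /a addr_gt0.
have T0 : 0 < T by rewrite /T addr_gt0.
(* The remainder of the iteration is nonnegative. *)
suff h : \sum_(m < n) (a / T) ^+ m * P m f g + T * (a / T) ^+ n * P n v g
    <= T * v g.
  apply: le_trans h; rewrite lerDl mulr_ge0 ?markov_ge0 //.
  by rewrite mulr_ge0 ?exprn_ge0 ?divr_ge0 // ltW.
elim: n => [|n IH]; first by rewrite big_ord0 add0r expr0 mulr1.
apply: le_trans IH; rewrite big_ord_recr /= -addrA lerD2l.
have h : P n f g <= T * P n v g - a * P n.+1 v g.
  rewrite -mulNr -markovZ iterSr -markovZ -markovD; apply: markov_le => x.
  by rewrite mulNr.
have q0 : 0 <= (a / T) ^+ n by rewrite exprn_ge0 // divr_ge0 // ltW.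
have := ler_wpM2l q0 h.
rewrite exprS -(mulrA a); set q := (a / T) ^+ n; set Y := P n.+1 v g.
have -> : T * (a * (T^-1 * q)) * Y = q * (a * Y) by field; rewrite gt_eqF.
by rewrite mulrBr; lra.
Qed.

Definition section_lenR d (g : basilica) : R := (section_len d g)%:R.

Lemma section_lenRM d g h :
  section_lenR d (g * h)%g <= section_lenR d g + section_lenR d h.
Proof. by rewrite -natrD ler_nat section_lenM. Qed.

(** With killing rate of order [1 / n] and [8 ^ J] of order [n], the sections at
    level [J.*2] have bounded mean length each, and there are [4 ^ J] of them. The
    potential only controls the average over times up to [n]; subadditivity moves
    the bound to time [n] itself, through the pairs of times [m] and [n - m]. *)
Lemma mean_section_len : exists C : R, 0 < C /\ forall n J,
  (8 ^ J <= n < 8 ^ J.+1)%N -> P n (section_lenR J.*2) 1%g <= C * 4 ^+ J.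
Proof.
pose mu := Num.min 1 r / 2.
have mu0 : 0 < mu by rewrite divr_gt0 // lt_min ltr01.
have [mu1 mur] : mu <= 1 / 2 /\ mu <= r / 2.
  by split; rewrite ler_pM2r ?invr_gt0 // ge_min lexx ?orbT.
pose K := (1 + r) * (9 / mu) + 1.
have a0 : 0 < 1 + r by lra.
have imu0 : 0 < 9 / mu by rewrite divr_gt0.
have K0 : 0 < K by rewrite addr_gt0 // mulr_gt0.
pose C := 2 * expR 1 * (2 + r) * K / mu.
have C0 : 0 < C by rewrite divr_gt0 // !mulr_gt0 ?expR_gt0 // addr_gt0.
exists C; split=> // n J /andP[nl nu].
have n0 : (0 < n)%N by rewrite (leq_trans _ nl) // expn_gt0.
have nR0 : (0 : R) < n%:R by rewrite ltr0n.
have nR1 : (1 : R) <= n%:R by rewrite ler1n.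
have {}nl : (8 : R) ^+ J <= n%:R by rewrite -natrX ler_nat.
have {}nu : (n%:R : R) <= 8 * 8 ^+ J by rewrite -exprS -natrX ler_nat ltnW.
set E : R := 8 ^+ J in nl nu; set F : R := 4 ^+ J.
have E0 : 0 < E by rewrite exprn_gt0.
have F0 : 0 < F by rewrite exprn_gt0.
pose k := mu / n%:R.
have k0 : 0 < k by rewrite divr_gt0.
have nk : n%:R * k = mu by rewrite /k mulrCA mulfV ?gt_eqF // mulr1.
have kmu : (E - 1) * k <= mu.
  rewrite /k mulrA ler_pdivrMr // mulrC ler_pM2l //; lra.
have [v [v0 vS vX]] : has_potential J.*2 k 1 r (F * K - 1).
  apply: potential_le k0 _ (@potential_iter _ mu J k 1 r mu0 k0 _ _);
    rewrite -/E -/F; try lra.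
  rewrite lerD2r ler_pM2l // lerD2r ler_wpM2l ?addr_ge0 ?ltW //.
  have : E^-1 / k <= 8 / mu.
    by rewrite /k invf_div mulrA ler_pM2r ?invr_gt0 // mulrC ler_pdivrMr.
  have : 0 < E^-1 / mu by rewrite divr_gt0 ?invr_gt0.
  rewrite mulrBl; lra.
have vS' g : section_lenR J.*2 g <= (k + (1 + r)) * v g - (1 + r) * markov v g.
  by rewrite markovE opprD !addrA; exact: vS.
have := potential_sum n.+1 1%g k0 v0 vS'.
have := vX 1%g; rewrite section_len1 add0r => v1.
set T := k + (1 + r) => sumT.
pose e m := P m (section_lenR J.*2) 1%g.
have e0 m : 0 <= e m by apply: markov_ge0 => h; rewrite ler0n.
have T0 : 0 < T by rewrite addr_gt0 // addr_gt0.
have sum_e : \sum_(m < n.+1) e m <= expR 1 * (T * v 1%g).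
  rewrite -ler_pdivrMl ?expR_gt0 //.
  apply: le_trans sumT; rewrite mulr_sumr; apply: ler_sum => m _.
  rewrite ler_wpM2r // -[(1 + r) / T]invf_div exprVn.
  rewrite lef_pV2 ?posrE ?expR_gt0 ?exprn_gt0 ?divr_gt0 //.
  have Ta : T / (1 + r) <= expR (k / (1 + r)).
    by apply: le_trans (expR_ge1Dx _); rewrite /T mulrDl mulfV ?gt_eqF // addrC.
  have Ta0 : 0 <= T / (1 + r) by rewrite divr_ge0 ?ltW.
  apply: le_trans (lerXn2r m _ _ Ta) _; rewrite ?nnegrE ?expR_ge0 //.
  rewrite -expRM_natl ler_expR.
  have mn : (m%:R : R) <= n%:R by rewrite ler_nat -ltnS.
  rewrite mulrA ler_pdivrMr // mul1r.
  have := ler_wpM2r (ltW k0) mn; rewrite nk; lra.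
(* Average of [e n <= e m + e (n - m)] over [m]. *)
have sum2 : n.+1%:R * e n <= 2 * \sum_(m < n.+1) e m.
  have -> : 2 * \sum_(m < n.+1) e m = \sum_(m < n.+1) (e m + e (n - m)%N).
    rewrite big_split /= mulr2n mulrDl mul1r; congr (_ + _).
    rewrite [RHS](reindex_inj rev_ord_inj) /=; apply: eq_bigr => m _.
    by rewrite subSS subKn // -ltnS.
  have -> : n.+1%:R * e n = \sum_(m < n.+1) e n.
    by rewrite sumr_const card_ord mulr_natl.
  apply: ler_sum => m _; rewrite /e -[in X in X <= _](subnKC (ltn_ord m : m <= n)%N).
  by apply: markov_subadditive; exact: section_lenRM.
have Tv : T * v 1%g <= (2 + r) * (F * K / k).
  apply: ler_pM => //; rewrite ?(ltW T0) //.
    rewrite /T /k; have : mu / n%:R <= mu by rewrite ler_pdivrMr // ler_peMr // ltW.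
    lra.
  by apply: le_trans v1 _; rewrite ler_pM2r ?invr_gt0 //; lra.
have : n%:R * e n <= n%:R * (C * F).
  have -> : n%:R * (C * F) = 2 * (expR 1 * ((2 + r) * (F * K / k))).
    by rewrite /C /k; field; rewrite !gt_eqF.
  apply: le_trans (ler_wpM2l _ (le_trans sum_e (ler_wpM2l _ Tv))); rewrite ?expR_ge0 //.
  apply: le_trans sum2; rewrite ler_wpM2r // ler_nat //.
by rewrite ler_pM2l.
Qed.

End Markov.

(** * Off-diagonal decay of powers of a symmetric substochastic matrix *)

Section Chebyshev.
Variable R : realType.
Local Open Scope ring_scope.

(** The pair of the Chebyshev polynomials [T_k] and [U_(k-1)], by the addition
    formulas of cosine and sine. *)
Fixpoint chebyshev (k : nat) : {poly R} * {poly R} :=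
  if k is k'.+1 then
    let: (t, u) := chebyshev k' in ('X * t - (1 - 'X * 'X) * u, t + 'X * u)
  else (1, 0).

(** The polynomial form of [cos ^ 2 + sin ^ 2 = 1]; it is what bounds
    [T_k] at a symmetric contraction without any spectral theory. *)
Lemma chebyshev_pell k : (chebyshev k).1 * (chebyshev k).1
  + (1 - 'X * 'X) * ((chebyshev k).2 * (chebyshev k).2) = 1.
Proof.
elim: k => [|k /=]; first by rewrite /= !mulr0 addr0 mulr1.
by case: (chebyshev k) => t u /= IH; rewrite -[RHS]IH; ring.
Qed.

Lemma chebyshev_rec k :
  (chebyshev k.+2).1 + (chebyshev k).1 = 2 * ('X * (chebyshev k.+1).1).
Proof. by rewrite /=; case: (chebyshev k) => t u /=; ring. Qed.

Lemma chebyshev1 : (chebyshev 1).1 = 'X.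
Proof. by rewrite /= mulr0 subr0 mulr1. Qed.

Section Sym.
Variables (N : nat) (M : 'M[R]_N.+1).
Hypothesis Msym : M^T = M.
Hypothesis M0 : forall i j, 0 <= M i j.
Hypothesis Mrow : forall i, \sum_j M i j <= 1.

(** Jensen's inequality along the rows, then summation along the columns, which
    by symmetry have sum at most [1] too. *)
Lemma substochastic_contraction (u : 'I_N.+1 -> R) :
  \sum_i (\sum_j M i j * u j) ^+ 2 <= \sum_j u j ^+ 2.
Proof.
apply: (@le_trans _ _ (\sum_i \sum_j M i j * u j ^+ 2)).
  apply: ler_sum => i _; set a := \sum_j _.
  have : 0 <= \sum_j M i j * (u j - a) ^+ 2.
    by apply: sumr_ge0 => j _; rewrite mulr_ge0 ?sqr_ge0.
  have -> : \sum_j M i j * (u j - a) ^+ 2 =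
     \sum_j M i j * u j ^+ 2 - 2 * a * a + a ^+ 2 * \sum_j M i j.
    rewrite (eq_bigr (fun j => M i j * u j ^+ 2 - 2 * a * (M i j * u j)
       + a ^+ 2 * M i j)); last by move=> j _; ring.
    by rewrite big_split /= sumrB -!mulr_sumr.
  have := ler_wpM2l (sqr_ge0 a) (Mrow i); rewrite mulr1; lra.
rewrite exchange_big /=; apply: ler_sum => j _.
rewrite -mulr_suml ler_piMl ?sqr_ge0 //.
rewrite (eq_bigr (M j)) ?Mrow // => i _; by rewrite -[in LHS]Msym mxE.
Qed.

Lemma horner_mx_sym p : (horner_mx M p)^T = horner_mx M p.
Proof.
elim/poly_ind: p => [|p c IH]; first by rewrite rmorph0 trmx0.
rewrite rmorphD rmorphM /= horner_mx_X horner_mx_C linearD /= tr_scalar_mx.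
congr (_ + _); rewrite trmx_mul IH Msym.
have : horner_mx M ('X * p) = horner_mx M (p * 'X) by rewrite mulrC.
by rewrite !rmorphM /= horner_mx_X.
Qed.

Lemma sym_sqr_diag (A : 'M[R]_N.+1) i : A^T = A -> (A * A) i i = \sum_j A i j ^+ 2.
Proof.
move=> sA; rewrite mxE; apply: eq_bigr => j _; rewrite expr2.
by rewrite -[in X in _ * X = _]sA mxE.
Qed.

(** By [chebyshev_pell], for [u] the row [i] of [U_(k-1)(M)], row [i] of [T_k(M)]
    has squared norm [1 - (|u|^2 - |M u|^2)], and [M] is a contraction. *)
Lemma chebyshev_le1 k i j : `|horner_mx M (chebyshev k).1 i j| <= 1.
Proof.
set T := horner_mx M _; set U := horner_mx M (chebyshev k).2.
have TT : T^T = T by exact: horner_mx_sym.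
have UU : U^T = U by exact: horner_mx_sym.
have UMS : (U * M)^T = U * M.
  by rewrite -[M]horner_mx_X -rmorphM; exact: horner_mx_sym.
have : T * T + U * U - (U * M) * (U * M) = 1.
  have /(congr1 (horner_mx M)) := chebyshev_pell k.
  have -> : (1 - 'X * 'X) * ((chebyshev k).2 * (chebyshev k).2) =
     (chebyshev k).2 * (chebyshev k).2
     - ((chebyshev k).2 * 'X) * ((chebyshev k).2 * 'X) by ring.
  by rewrite addrA rmorphB rmorphD !rmorphM /= horner_mx_X rmorph1.
move=> /(congr1 (fun A : 'M[R]_N.+1 => A i i)).
have mD (A B : 'M[R]_N.+1) : (A + B) i i = A i i + B i i by rewrite mxE.
have mN (A : 'M[R]_N.+1) : (- A) i i = - A i i by rewrite mxE.
have m1 : (1 : 'M[R]_N.+1) i i = 1 by rewrite mxE eqxx.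
rewrite mD mD mN m1 !sym_sqr_diag //.
have := substochastic_contraction (U i).
have -> : \sum_l (\sum_j0 M l j0 * U i j0) ^+ 2 = \sum_l (U * M) i l ^+ 2.
  apply: eq_bigr => l _; rewrite [in RHS]mxE; congr (_ ^+ 2).
  by apply: eq_bigr => m _; rewrite mulrC -{1}Msym mxE.
have : T i j ^+ 2 <= \sum_l T i l ^+ 2.
  by rewrite (bigD1 j) //= lerDl sumr_ge0 // => l _; rewrite sqr_ge0.
move=> h1 h2 h3; rewrite -(@expr_le1 _ 2) // real_normK ?num_real //; lra.
Qed.

Variables (x theta : R) (i j : 'I_N.+1).
Hypothesis theta_ge0 : 0 <= theta.
Hypothesis far : forall k, k%:R < x -> horner_mx M (chebyshev k).1 i j = 0.

(** Write [X ^+ m] as the mean of [T_|S_m|] for the simple random walk [S_m] on the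
    integers: entry [i j] of [T_k(M)] vanishes for [k < x] and is at most [1]
    otherwise, so the entry of [M ^+ m] is at most the probability of
    [|S_m| >= x], which an exponential moment bounds. The induction runs these two
    estimates together, on [X ^+ m * T_k] for all [k]. *)
Lemma carne_matrix m : `|(M ^+ m) i j| <=
  2 * expR (- (theta * x)) * ((expR theta + expR (- theta)) / 2) ^+ m.
Proof.
set ch := _ / 2.
pose F m k := horner_mx M ('X ^+ m * (chebyshev k).1) i j.
have ch0 : 0 <= ch by rewrite divr_ge0 ?addr_ge0 ?expR_ge0.
have F0 k : F 0%N k = horner_mx M (chebyshev k).1 i j by rewrite /F expr0 mul1r.
have FS0 m' : F m'.+1 0%N = F m' 1%N.
  by rewrite /F chebyshev1 exprSr mulr1.
have FSS m' k : 2 * F m'.+1 k.+1 = F m' k.+2 + F m' k.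
  rewrite /F; have /(congr1 (fun p => horner_mx M ('X ^+ m' * p))) := chebyshev_rec k.
  have -> : 'X ^+ m' * (2 * ('X * (chebyshev k.+1).1)) =
    'X ^+ m'.+1 * (chebyshev k.+1).1 + 'X ^+ m'.+1 * (chebyshev k.+1).1 :> {poly R}.
    by rewrite exprSr; ring.
  rewrite mulrDr !rmorphD => /(congr1 (fun A : 'M[R]_N.+1 => A i j)).
  by rewrite mxE [X in _ = X -> _]mxE => ->; ring.
pose t := expR theta; pose s := expR (- theta).
have ts : t * s = 1 by rewrite /t /s -expRD subrr expR0.
have tk k : expR (theta * k%:R) = t ^+ k by rewrite expRM_natr.
have sk k : expR (- (theta * k%:R)) = s ^+ k by rewrite -mulNr expRM_natr.
have bound m' k : `|F m' k| <= expR (- (theta * x)) * ch ^+ m' * (t ^+ k + s ^+ k).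
  set e := expR _; have e0 : 0 <= e by exact: expR_ge0.
  have t0 n : 0 <= t ^+ n by rewrite exprn_ge0 ?expR_ge0.
  have s0 n : 0 <= s ^+ n by rewrite exprn_ge0 ?expR_ge0.
  elim: m' k => [|m' IH] k.
    rewrite F0 expr0 mulr1; have [kx|xk] := ltP k%:R x.
      by rewrite far // normr0 mulr_ge0 ?addr_ge0.
    apply: le_trans (chebyshev_le1 k i j) _.
    rewrite mulrDr ler_wpDr ?mulr_ge0 //.
    rewrite -tk /e -expRD -[leLHS]expR0 ler_expR addrC subr_ge0.
    exact: ler_wpM2l.
  have chE : ch = (t + s) / 2 by [].
  case: k => [|k].
    rewrite FS0; apply: le_trans (IH 1%N) _; rewrite !expr1 !expr0 exprSr chE.
    by rewrite le_eqVlt; apply/orP; left; apply/eqP; field.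
  have : 2 * `|F m'.+1 k.+1| <= `|F m' k.+2| + `|F m' k|.
    by rewrite -[2]normr_nat -normrM FSS ler_normD.
  have := IH k.+2; have := IH k.
  have -> : e * ch ^+ m'.+1 * (t ^+ k.+1 + s ^+ k.+1) =
      (e * ch ^+ m' * (t ^+ k.+2 + s ^+ k.+2)
       + e * ch ^+ m' * (t ^+ k + (t * s) * s ^+ k - (1 - t * s) * t ^+ k)) / 2.
    by rewrite exprSr chE !exprS; field.
  rewrite ts subrr mul0r subr0 mul1r; lra.
have := bound m 0%N.
rewrite /F /= mulr1 rmorphXn /= horner_mx_X !expr0.
by rewrite mulrC mulrA.
Qed.

End Sym.
End Chebyshev.

(** For small [theta] from [expR y <= (1 - y)^-1] at [theta] and [- theta]; for
    large [theta] the exponent [2 * theta ^+ 2] exceeds [theta]. *)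
Lemma cosh_le (R : realType) (theta : R) : 0 <= theta ->
  (expR theta + expR (- theta)) / 2 <= expR (2 * theta ^+ 2).
Proof.
move=> t0; have [t2|t2] := leP theta (1 / 2); last first.
  have h : expR (- theta) <= expR theta by rewrite ler_expR; lra.
  apply: (@le_trans _ _ (expR theta)); first by lra.
  rewrite ler_expR; nra.
have ub (y : R) : y < 1 -> expR y <= (1 - y)^-1.
  move=> y1; rewrite -[y]opprK expRN lef_pV2 ?posrE ?expR_gt0 ?subr_gt0 //.
    by have := expR_ge1Dx (- y); rewrite opprK addrC.
  by rewrite opprK; lra.
have h1 := ub theta (ltac:(lra)); have h2 := ub (- theta) (ltac:(lra)).
apply: (@le_trans _ _ (1 - theta ^+ 2)^-1).
  have -> : (1 - theta ^+ 2)^-1 = ((1 - theta)^-1 + (1 - - theta)^-1) / 2.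
    by field; rewrite !gt_eqF //; nra.
  lra.
have y0 := sqr_ge0 theta.
have y1 : theta ^+ 2 <= 1 / 4 by rewrite expr2; nra.
rewrite -[leLHS]mul1r ler_pdivrMr; last by lra.
have y2 : 0 <= 1 - theta ^+ 2 by lra.
have := ler_wpM2r y2 (expR_ge1Dx (2 * theta ^+ 2)).
move: (theta ^+ 2) y0 y1 y2 => y; nra.
Qed.

(** * The Varopoulos-Carne bound *)

Section Carne.
Variables (R : realType) (r : R).
Hypothesis r_gt0 : 0 < r.
Local Notation P n := (iter n (markov r)).

Definition word_ball n : seq basilica :=
  undup (map (fun t : {bseq n of letter} => word_value t) (enum {bseq n of letter})).

Lemma mem_word_ball n g : (wlen g <= n)%N -> g \in word_ball n.
Proof.
have [w <- <-] := wlen_word g => wn; rewrite mem_undup.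
by apply/mapP; exists (Bseq wn); rewrite ?mem_enum.
Qed.

Lemma step_weight_inv l : step_weight r (inv_letter l) = step_weight r l.
Proof. by []. Qed.

Lemma inv_letterK : involutive inv_letter.
Proof. by case=> [? []]. Qed.

(** The matrix bound applied to the walk killed on leaving a finite ball that
    contains every trajectory of length [m] from [1] and the target [g]. *)
Lemma carne theta m g : 0 <= theta ->
  P m (fun h => (h == g)%:R) 1%g <=
    2 * expR (- (theta * (wlen g)%:R) + 2 * theta ^+ 2 * m%:R).
Proof.
move=> th0; pose n := (maxn m (wlen g)); pose S := word_ball n.
have memS h : (wlen h <= n)%N -> h \in S := @mem_word_ball n h.
have S1 : 1%g \in S by rewrite memS // wlen1.
have Sg : g \in S by rewrite memS // leq_maxr.
have szS : (size S).-1.+1 = size S by rewrite prednK //; case: (S) S1.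
(* Indices in ['I_N.+1] make the matrices a ring; [S] is not empty. *)
pose N := (size S).-1; pose pt (i : 'I_N.+1) : basilica := nth 1%g S i.
have idx h : h \in S -> exists i, pt i = h.
  move=> hS; have hi : (index h S < N.+1)%N by rewrite /N szS index_mem.
  by exists (Ordinal hi); rewrite /pt /= nth_index.
have pt_inj : injective pt.
  move=> i j /eqP; rewrite /pt nth_uniq ?undup_uniq ?szS //; try by rewrite -szS.
  by move/eqP/val_inj.
pose M : 'M[R]_N.+1 :=
  \matrix_(i, j) \sum_l step_weight r l * ((pt i * gen l)%g == pt j)%:R.
have M0 i j : 0 <= M i j.
  by rewrite mxE sumr_ge0 // => l _; rewrite mulr_ge0 ?step_weight_ge0.
have Msym : M^T = M.
  apply/matrixP => i j; rewrite !mxE (reindex_inj (inv_inj inv_letterK)) /=.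
  apply: eq_bigr => l _; rewrite step_weight_inv gen_inv; congr (_ * _%:R).
  by rewrite divg_eq eq_sym.
have Mrow i : \sum_j M i j <= 1.
  under eq_bigr do rewrite mxE; rewrite exchange_big /=.
  rewrite -[leRHS](step_weight_sum r_gt0); apply: ler_sum => l _.
  rewrite -mulr_sumr ler_piMr ?step_weight_ge0 //.
  have [/idx[j jE]|nS] := boolP ((pt i * gen l)%g \in S).
    rewrite (bigD1 j) //= jE eqxx big1 ?addr0 // => j' j'j.
    by rewrite -jE (inj_eq pt_inj) eq_sym (negbTE j'j).
  rewrite big1 // => j _; case: eqP => // E; case/negP: nS; rewrite E.
  by rewrite /pt mem_nth // -szS.
have Mwlen i j : (wlen (pt i) + 1 < wlen (pt j))%N -> M i j = 0.
  move=> ij; rewrite mxE big1 // => l _; case: eqP => [E|_]; rewrite ?mulr0 //.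
  by move: ij; rewrite -E ltnNge (leq_trans (wlenM _ _)) // leq_add2l wlen_gen.
have [i1 i1E] := idx _ S1; have [jg jgE] := idx _ Sg.
have far k i j : (wlen (pt i) + k < wlen (pt j))%N ->
    horner_mx M (chebyshev R k).1 i j = 0.
  (* Two consecutive degrees together, for the three-term recurrence. *)
  suff : forall i j,
     ((wlen (pt i) + k < wlen (pt j))%N ->
        horner_mx M (chebyshev R k).1 i j = 0) /\
     ((wlen (pt i) + k.+1 < wlen (pt j))%N ->
        horner_mx M (chebyshev R k.+1).1 i j = 0).
    by move=> /(_ i j)[].
  elim: k {i j} => [|k IH] i j; split.
  - rewrite addn0 rmorph1 mxE; case: eqP => // ->; by rewrite ltnn.
  - by rewrite chebyshev1 horner_mx_X; exact: Mwlen.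
  - by case: (IH i j).
  - move=> ij; have /(congr1 (horner_mx M)) := chebyshev_rec R k.
    have -> : 2 * ('X * (chebyshev R k.+1).1) =
      (chebyshev R k.+1).1 * 'X + (chebyshev R k.+1).1 * 'X by ring.
    rewrite !rmorphD !rmorphM /= horner_mx_X => /(congr1 (fun A : 'M[R]_N.+1 => A i j)).
    have E : (horner_mx M (chebyshev R k.+1).1 * M) i j = 0.
      rewrite mxE big1 // => l _.
      have [lj|jl] := ltnP (wlen (pt l) + 1) (wlen (pt j)).
        by rewrite Mwlen ?mulr0.
      have [_ ->] := IH i l; rewrite ?mul0r //.
      by move: ij jl; lia.
    rewrite mxE [X in _ = X -> _]mxE E addr0.
    rewrite (IH i j).1 ?addr0 //; move: ij; lia.
(* No killing occurs as long as the ball of radius [a] about [pt i] stays in [S]. *)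
have MP a i : (wlen (pt i) + a <= n)%N ->
    (M ^+ a) i jg = P a (fun h => (h == g)%:R) (pt i).
  elim: a i => [|a IH] i ia.
    by rewrite expr0 mxE /= -jgE (inj_eq pt_inj).
  rewrite exprS mxE iterS /markov.
  under eq_bigr do rewrite mxE mulr_suml.
  rewrite exchange_big /=; apply: eq_bigr => l _.
  have li : (wlen (pt i * gen l)%g <= wlen (pt i) + 1)%N.
    by rewrite (leq_trans (wlenM _ _)) // leq_add2l wlen_gen.
  have [j jE] : exists j, pt j = (pt i * gen l)%g.
    by apply/idx/memS; rewrite (leq_trans li) // (leq_trans _ ia) // leq_add2l.
  rewrite (bigD1 j) //= -jE eqxx mulr1 big1 ?addr0 => [|j' j'j].
    rewrite IH // jE (leq_trans _ ia) // addnS -addSn leq_add2r -addn1 //.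
  by rewrite (inj_eq pt_inj) eq_sym (negbTE j'j) mulr0 mul0r.
have := carne_matrix Msym M0 Mrow th0 (x := (wlen g)%:R) (i := i1) (j := jg) _ m.
rewrite MP i1E ?wlen1 ?leq_maxl // => H.
apply: le_trans (ler_norm _) (le_trans (H _) _).
  by move=> k; rewrite ltr_nat => kg; apply: far; rewrite i1E wlen1 jgE.
rewrite expRD -mulrA ler_pM2l // ler_pM2l ?expR_gt0 // expRM_natr.
by rewrite lerXn2r ?nnegrE ?expR_ge0 ?divr_ge0 ?addr_ge0 ?expR_ge0 // cosh_le.
Qed.

End Carne.

(** * Counting elements by total section length *)

Section Counting.
Variable R : realType.

Lemma sum_inj_le (S T : eqType) (phi : S -> T) (F : T -> R) (s : seq S) (t : seq T) :
  uniq s -> uniq t -> {in s &, injective phi} -> {subset map phi s <= t} ->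
  (forall y, 0 <= F y) -> \sum_(x <- s) F (phi x) <= \sum_(y <- t) F y.
Proof.
move=> us ut inj st F0; rewrite -(big_map phi xpredT F).
rewrite [leRHS](bigID (fun y => y \in map phi s)) /= -[X in _ <= X + _]big_filter.
have pe : perm_eq [seq y <- t | y \in map phi s] (map phi s).
  apply: uniq_perm; rewrite ?filter_uniq ?map_inj_in_uniq // => y.
  by rewrite mem_filter; case: (boolP (y \in map phi s)) => // /st ->.
rewrite (perm_big _ pe) /=.
by rewrite lerDl sumr_ge0.
Qed.

(** The factor [3] makes the weights of the four letters sum to at most
    [1 / 2], as [expR (- 3) <= 1 / 8]. *)
Definition section_weight d (g : basilica) : R := expR (- (3 * (section_len d g)%:R)).

Lemma expRN3_le : expR (- 3) <= 1 / 8 :> R.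
Proof.
have h : (2 : R) <= expR 1 by have := @expR_ge1Dx R 1; lra.
have -> : - 3 = - (1 + (1 + 1)) :> R by ring.
rewrite expRN div1r lef_pV2 ?posrE ?expR_gt0 // !expRD.
by move: (expR 1 : R) h => e; nra.
Qed.

Lemma word_weight_sum (ws : seq (seq letter)) : uniq ws ->
  \sum_(w <- ws) expR (- (3 * (size w)%:R)) <= 2 :> R.
Proof.
move=> uws; pose n := \max_(w <- ws) size w.
have wn w : w \in ws -> (size w < n.+1)%N.
  by move=> h; rewrite ltnS /n; apply: leq_bigmax_seq.
have -> : \sum_(w <- ws) expR (- (3 * (size w)%:R)) =
   \sum_(j < n.+1) \sum_(w <- ws | size w == j) expR (- (3 * (size w)%:R)) :> R.
  rewrite (exchange_big_dep xpredT) //= big_seq [RHS]big_seq.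
  apply: eq_bigr => w /wn h; rewrite (bigD1 (Ordinal h)) //= big1 ?addr0 // => j.
  by move=> /andP[/eqP wj /eqP[]]; exact: val_inj.
apply: (@le_trans _ _ (\sum_(j < n.+1) (1 / 2) ^+ j)).
  apply: ler_sum => j _.
  rewrite (eq_bigr (fun=> expR (- 3) ^+ j)) => [|w /eqP ->]; last first.
    by rewrite -mulNr expRM_natr.
  rewrite -big_filter big_const_seq count_predT iter_addr_0 -[leLHS]mulr_natr.
  have c4 : (size [seq w <- ws | size w == j] <= 4 ^ j)%N.
    have -> : (4 ^ j = size (map val (enum {: j.-tuple letter})))%N.
      by rewrite size_map -cardT card_tuple card_prod card_bool.
    apply: uniq_leq_size; rewrite ?filter_uniq // => w.
    rewrite mem_filter => /andP[wj _].
    by apply/mapP; exists (Tuple wj); rewrite ?mem_enum.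
  have -> : (1 / 2) ^+ j = (1 / 8) ^+ j * (4 ^ j)%:R :> R.
    by rewrite natrX -exprMn; congr (_ ^+ _); field.
  apply: ler_pM; rewrite ?exprn_ge0 ?expR_ge0 ?ler0n ?ler_nat //.
  by rewrite lerXn2r ?nnegrE ?expR_ge0 ?divr_ge0 // expRN3_le.
suff -> : \sum_(j < n.+1) (1 / 2) ^+ j = 2 - 2 * (1 / 2) ^+ n.+1 :> R.
  by rewrite gerBl mulr_ge0 ?exprn_ge0.
elim: n.+1 => [|m IH]; first by rewrite big_ord0 expr0; ring.
by rewrite big_ord_recr /= IH exprS; field.
Qed.

(** The number of elements with [section_len d] at most [t] is thus at most
    [expR (3 * t) * 4 ^+ (2 ^ d)]. For [d = 0] choose a shortest word for each
    element; for the step, [sec_inj] embeds the group in two copies of itself and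
    one bit. *)
Lemma section_count d (s : seq basilica) : uniq s ->
  2 * \sum_(g <- s) section_weight d g <= 4 ^+ (2 ^ d).
Proof.
have W0 d' x : 0 <= section_weight d' x by exact: expR_ge0.
elim: d s => [|d IH] s us.
  rewrite expn0 expr1; suff : \sum_(g <- s) section_weight 0 g <= 2 by lra.
  have wd g : {w | word_value w = g & size w = wlen g} := cid2 (wlen_word g).
  pose f g := s2val (wd g); have fv g : word_value (f g) = g := s2valP (wd g).
  have fs g : size (f g) = wlen g := s2valP' (wd g).
  have := @word_weight_sum (map f s).
  rewrite map_inj_uniq; last exact: can_inj fv.
  rewrite big_map => /(_ us); apply: le_trans.
  by rewrite le_eqVlt; apply/orP; left; apply/eqP; apply: eq_bigr => g _; rewrite fs.
pose phi g := ((sec g false, sec g true), bact g false).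
pose S i := undup (map (sec ^~ i) s).
pose F (x : basilica * basilica * bool) :=
  section_weight d x.1.1 * section_weight d x.1.2.
have FE g : section_weight d.+1 g = F (phi g).
  by rewrite /F /section_weight -expRD /= natrD; congr expR; ring.
pose T := [seq (x, b) | x <- [seq (y, z) | y <- S false, z <- S true],
                       b <- [:: true; false]].
have le1 : \sum_(g <- s) section_weight d.+1 g <= \sum_(x <- T) F x.
  under eq_bigr do rewrite FE.
  apply: sum_inj_le => //.
  - apply: allpairs_uniq => //; last by move=> [? ?] [? ?] _ _ [-> ->].
    by apply: allpairs_uniq; rewrite ?undup_uniq //; move=> [? ?] [? ?] _ _ [-> ->].
  - move=> g h _ _ E; apply: sec_inj => [[]|].
    + exact: (congr1 (fun x => x.1.2) E).
    + exact: (congr1 (fun x => x.1.1) E).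
    + exact: (congr1 snd E).

  - move=> _ /mapP[g gs ->]; apply/allpairsP; exists (phi g).
    split=> //; last by rewrite /=; case: (bact g false).
    apply/allpairsP; exists (phi g).1.
    split=> //; rewrite mem_undup.
      exact: (map_f (sec ^~ false) gs).
    exact: (map_f (sec ^~ true) gs).
  - by move=> x; rewrite mulr_ge0.
have TE : \sum_(x <- T) F x = 2 * ((\sum_(y <- S false) section_weight d y)
    * (\sum_(z <- S true) section_weight d z)).
  rewrite big_allpairs_dep big_allpairs_dep /= mulr_suml mulr_sumr.
  apply: eq_bigr => y _; rewrite mulr_sumr mulr_sumr; apply: eq_bigr => z _.
  by rewrite !big_cons big_nil /F /=; ring.
have h0 := IH _ (undup_uniq (map (sec ^~ false) s)).
have h1 := IH _ (undup_uniq (map (sec ^~ true) s)).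
have := ler_pM (mulr_ge0 (ler0n R 2) (sumr_ge0 _ (fun y _ => W0 d y)))
   (mulr_ge0 (ler0n R 2) (sumr_ge0 _ (fun y _ => W0 d y))) h0 h1.
rewrite -exprD addnn -mul2n -expnS; apply: le_trans.
apply: le_trans (ler_wpM2l _ le1) _ => //; rewrite TE.
by rewrite le_eqVlt; apply/orP; left; apply/eqP; ring.
Qed.

End Counting.

(** * The displacement at a fixed time and the maximal inequality *)

Section Tail.
Variables (R : realType) (r : R).
Hypothesis r_gt0 : 0 < r.
Local Notation P n := (iter n (markov r)).

Definition longer (x : R) (g : basilica) : R := (x < (wlen g)%:R)%R%:R.

(** If the total section length is at most [t], the walk is at one of the few
    elements counted by [section_count], and by [carne] each of those with word
    length above [x] is unlikely; Markov's inequality treats the case of a larger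
    total section length. *)
Lemma tail_decomposition n d x t theta : 0 < t -> 0 <= theta ->
  P n (longer x) 1%g <= P n (section_lenR R d) 1%g / t
    + expR (3 * t - theta * x + 2 * theta ^+ 2 * n%:R) * 4 ^+ (2 ^ d).
Proof.
move=> t0 th0; pose S := [seq h <- word_ball n | x < (wlen h)%:R].
pose W h := expR (3 * t) * section_weight R d h.
have W0 h : 0 <= W h by rewrite mulr_ge0 ?expR_ge0.
have pt g : (wlen g <= wlen 1%g + n)%N -> longer x g <=
    t^-1 * section_lenR R d g + \sum_(h <- S) W h * (g == h)%:R.
  rewrite wlen1 add0n => /mem_word_ball gB.
  have sum0 : 0 <= \sum_(h <- S) W h * (g == h)%:R.
    by apply: sumr_ge0 => h _; rewrite mulr_ge0.
  have L0 : 0 <= t^-1 * section_lenR R d g.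
    by rewrite mulr_ge0 ?invr_ge0 // ?ler0n // ltW.
  rewrite /longer; case: ltP => [xg|_]; last by rewrite addr_ge0.
  have [tL|Lt] := leP t (section_lenR R d g).
    by rewrite ler_wpDr // mulrC ler_pdivlMr // mul1r.
  rewrite ler_wpDl // (bigD1_seq g) ?filter_uniq ?undup_uniq ?mem_filter ?xg ?gB //=.
  rewrite eqxx mulr1 ler_wpDr //; first by apply: sumr_ge0 => h _; rewrite mulr_ge0.
  rewrite /W -expRD -[leLHS]expR0 ler_expR -/(section_lenR R d g); lra.
apply: le_trans (markov_le_ball r_gt0 pt) _.
rewrite markovD markovZ markov_sum mulrC lerD2l.
set E := theta * x; pose c := 2 * expR (- E + 2 * theta ^+ 2 * n%:R).
apply: (@le_trans _ _ (\sum_(h <- S) W h * c)).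
  rewrite big_seq [leRHS]big_seq; apply: ler_sum => h.
  rewrite mem_filter => /andP[xh _]; rewrite markovZ ler_wpM2l //.
  apply: le_trans (carne r_gt0 n h th0) _.
  by rewrite ler_pM2l // ler_expR lerD2r lerN2 ler_wpM2l // ltW.
have uS : uniq S by rewrite filter_uniq ?undup_uniq.
have := section_count R d uS.
rewrite -mulr_suml -mulr_sumr /c => cnt.
have -> : 3 * t - E + 2 * theta ^+ 2 * n%:R =
  3 * t + (- E + 2 * theta ^+ 2 * n%:R) by ring.
rewrite [expR (3 * t + _)]expRD; set a := expR (3 * t).
set b := expR (- E + 2 * theta ^+ 2 * n%:R).
have -> : a * (\sum_(i <- S) section_weight R d i) * (2 * b) =
  a * b * (2 * \sum_(i <- S) section_weight R d i) by ring.
by rewrite ler_wpM2l // mulr_ge0 ?expR_ge0.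
Qed.

Lemma powR_twothirds (n : R) : 0 < n -> (n `^ (2 / 3)) ^+ 3 = n ^+ 2.
Proof.
move=> n0; rewrite -powR_mulrn ?powR_ge0 // -powRrM -powR_mulrn ?ltW //.
by congr powR; field.
Qed.

Lemma powR_fivesixths (n : R) : 0 < n -> (n `^ (5 / 6)) ^+ 2 = n * n `^ (2 / 3).
Proof.
move=> n0; rewrite -powR_mulrn ?powR_ge0 // -powRrM.
rewrite -[n in X in _ = X * _]powRr1 ?ltW //.
by rewrite -powRD ?gt_eqF ?implybT //; congr powR; field.
Qed.

(** Here [N = n^(2/3)] bounds both the number [4 ^ J] of sections and, up to a
    constant, their mean total length. Taking [t] of order [lambda * N], the count
    contributes at most [expR] of order [lambda * N] while for [x = lambda * n^(5/6)]
    the Gaussian factor is [expR (- lambda ^+ 2 * N / 8)], and it wins for large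
    [lambda]. *)
Lemma tail_bound : exists C : R, 0 < C /\ forall n (lambda : R),
  (0 < n)%N -> 0 < lambda -> P n (longer (lambda * n%:R `^ (5 / 6))) 1%g <= C / lambda.
Proof.
have [C1 [C10 mean]] := mean_section_len r_gt0.
exists (12 * C1 + 17); split=> [|n lambda n0 l0]; first lra.
have [l16|l16] := ltP lambda 16.
  apply: (@le_trans _ _ 1); last by rewrite ler_pdivlMr //; lra.
  rewrite -[leRHS](markov_cst r_gt0 n 1 1%g); apply: markov_le => // g.
  by rewrite /longer; case: ltP.
pose J := trunc_log 8 n.
have /andP[Jl Ju] : (8 ^ J <= n < 8 ^ J.+1)%N by rewrite trunc_logP ?trunc_log_ltn.
have nR0 : (0 : R) < n%:R by rewrite ltr0n.
pose N : R := n%:R `^ (2 / 3).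
have N3 : N ^+ 3 = n%:R ^+ 2 by exact: powR_twothirds.
have N0 : 0 <= N by exact: powR_ge0.
have N1 : 1 <= N.
  by rewrite -(@expr_ge1 _ 3) // N3 exprn_ege1 // ler1n.
have FN : 4 ^+ J <= N.
  rewrite -(@ler_pXn2r _ 3) ?nnegrE ?exprn_ge0 // N3 -exprM mulnC exprM.
  have -> : (4 : R) ^+ 3 = 8 ^+ 2 by ring.
  rewrite -exprM mulnC exprM lerXn2r ?nnegrE ?exprn_ge0 ?ler0n // -natrX ler_nat //.
have em := mean n J; rewrite Jl Ju in em.
have {}em := em isT.
set x := lambda * _.
have x2 : x ^+ 2 = lambda ^+ 2 * (n%:R * N).
  by rewrite /x exprMn powR_fivesixths.
have x0 : 0 <= x by rewrite mulr_ge0 ?powR_ge0 // ltW.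
(* [theta] minimizes the exponent in [tail_decomposition]. *)
pose t := lambda * N / 12; pose theta := x / (4 * n%:R).
have t0 : 0 < t by rewrite divr_gt0 // mulr_gt0 //; lra.
have th0 : 0 <= theta.
  by apply: divr_ge0 => //; apply: mulr_ge0 => //; rewrite ler0n.
apply: le_trans (tail_decomposition n J.*2 x t0 th0) _.
have -> : (12 * C1 + 17) / lambda = 12 * C1 / lambda + lambda^-1 + 16 / lambda.
  by field; rewrite gt_eqF.
have s0 : 0 <= 16 / lambda by rewrite divr_ge0 // ltW.
apply: le_trans (_ : _ <= 12 * C1 / lambda + lambda^-1) _; last by rewrite lerDl.
apply: lerD.
  rewrite ler_pdivrMr //; apply: le_trans em _.
  have -> : 12 * C1 / lambda * t = C1 * N by rewrite /t; field; rewrite gt_eqF.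
  by rewrite ler_pM2l.
have e2 : (4 : R) <= expR 2.
  have -> : (2 : R) = 1 + 1 by ring.
  rewrite expRD; have := @expR_ge1Dx R 1; move: (expR 1) => e; nra.
have cnt : (4 : R) ^+ (2 ^ J.*2) <= expR (2 * N).
  have -> : (2 ^ J.*2 = 4 ^ J)%N by rewrite -mul2n expnM.
  apply: le_trans (lerXn2r _ _ _ e2) _; rewrite ?nnegrE ?expR_ge0 //.
  rewrite -expRM_natr ler_expR ler_pM2l // natrX //.
apply: le_trans (ler_wpM2l (expR_ge0 _) cnt) _.
rewrite -expRD.
have -> : 3 * t - theta * x + 2 * theta ^+ 2 * n%:R + 2 * N =
   lambda * N / 4 - lambda ^+ 2 * N / 8 + 2 * N.
  have -> : theta * x = x ^+ 2 / (4 * n%:R) by rewrite /theta; field; rewrite gt_eqF.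
  have -> : theta ^+ 2 = x ^+ 2 / (16 * n%:R ^+ 2).
    by rewrite /theta; field; rewrite gt_eqF.
  by rewrite x2 /t; field; rewrite gt_eqF.
apply: (@le_trans _ _ (expR (- lambda))).
  rewrite ler_expR.
  have h1 : 16 * lambda <= lambda ^+ 2 by rewrite expr2 ler_pM2r.
  have h2 := ler_wpM2r N0 h1.
  have h3 := ler_wpM2r N0 l16.
  have h4 := ler_wpM2l (ltW l0) N1.
  lra.
rewrite expRN lef_pV2 ?posrE ?expR_gt0 //.
have := @expR_ge1Dx R lambda; lra.
Qed.

(** The probability that the walk started at [g] has word length above [y] at some
    time up to [n]. *)
Fixpoint hit_prob (y : R) (n : nat) (g : basilica) : R :=
  if y < (wlen g)%:R then 1 else if n is n'.+1 then markov r (hit_prob y n') g else 0.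

(** Ottaviani's maximal inequality: from a point of length above [2 * x] the walk
    can return to length at most [x] only by travelling more than [x], which has
    probability at most [1 / 2] by translation invariance. *)
Lemma hit_prob_le x n g :
  (forall j, (j <= n)%N -> P j (longer x) 1%g <= 1 / 2) ->
  hit_prob (2 * x) n g <= 2 * P n (longer x) g.
Proof.
have start m h : 2 * x < (wlen h)%:R -> P m (longer x) 1%g <= 1 / 2 ->
    1 <= 2 * P m (longer x) h.
  move=> xh half.
  suff : 1 <= P m (longer x) h + P m (longer x) 1%g by lra.
  rewrite -[leLHS](markov_cst r_gt0 m 1 1%g) -[h in X in _ <= X + _]mulg1.
  rewrite -markov_translate -markovD.
  apply: markov_le => // y; rewrite /longer.
  have : ((wlen h)%:R : R) <= (wlen (h * y)%g)%:R + (wlen y)%:R.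
    by rewrite -natrD ler_nat -[X in (wlen X <= _)%N](mulgK y) -(wlenV y) wlenM.
  by case: ltP => h1; case: ltP => h2 hle /=; move: hle xh h1 h2; lra.
elim: n g => [|n IH] g half /=.
  case: ltP => [xg|_]; first by apply: (start 0%N g xg); apply: half.
  by rewrite mulr_ge0 // /longer ler0n.
case: ltP => [xg|_]; first by apply: (start n.+1 g xg); apply: half.
rewrite /markov mulr_sumr; apply: ler_sum => l _.
rewrite mulrCA ler_wpM2l ?step_weight_ge0 //.
by apply: IH => j jn; apply: half; rewrite leqW.
Qed.

End Tail.

(** * From the transition operator to the probability space *)

(** [a] and [b] differ on the first level, and neither is an involution. *)
Lemma gen_inj : injective gen.
Proof.
move=> l l' E.
have E1 : l.1 = l'.1 by have := congr1 (bact ^~ false) E; rewrite !bact_gen !addbF.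
case: l l' E E1 => [c i] [c' i'] /= E E1; rewrite -{c'}E1 in E *; congr (_, _).
(* The square of [a] or [b] moves the vertex [1111]. *)
have nsq : (gen (c, false) * gen (c, false))%g <> 1%g.
  move=> /(congr1 (fun g : basilica => (g : tree_aut) [:: true; true; true; true])).
  by case: {E} c.
have nV : gen (c, true) = (gen (c, false))^-1%g by rewrite -gen_inv.
have nVV : gen (c, true) <> gen (c, false).
  by move=> V; apply: nsq; rewrite -{2}V nV mulgV.
by case: i i' E => [] [] // E; case: nVV; rewrite E.
Qed.

Section Law.
Variables (R : realType) (r : R).
Hypothesis r_gt0 : 0 < r.
Variables (d : measure_display) (T : measurableType d) (P : probability T R).
Variable s : nat -> {RV P >-> basilica}.
Hypothesis steps : walk_steps r s.

Lemma step_lawE (A : set basilica) :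
  step_law r A = (\sum_l step_weight r l * (gen l \in A)%:R)%:E.
Proof.
rewrite /step_law !diracE sum_letter /step_weight /gen /=.
pose ind l : R := (gen l \in A)%:R.
apply: (congr1 EFin (_ : (2 + 2 * r)^-1 * (ind (false, false) + ind (false, true)
  + r * ind (true, false) + r * ind (true, true)) = _)).
rewrite /ind; field.
by rewrite gt_eqF // addr_gt0 ?mulr_gt0.
Qed.

Lemma measurable_step i (A : set basilica) : measurable (s i @^-1` A).
Proof. by rewrite -[X in measurable X]setTI; apply: (measurable_funP (s i)). Qed.

Lemma step_prob i (A : set basilica) :
  P (s i @^-1` A) = (\sum_l step_weight r l * (gen l \in A)%:R)%:E.
Proof. have [law _] := steps; by rewrite -step_lawE -(law i). Qed.

Lemma step_gen i l : P (s i @^-1` [set gen l]) = (step_weight r l)%:E.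
Proof.
rewrite step_prob (bigD1 l) //= big1 ?addr0.
  have -> : (gen l \in [set gen l]) = true by exact: mem_set.
  by rewrite mulr1.
move=> l' l'l; rewrite (_ : gen l' \in [set gen l] = false) ?mulr0 //.
by apply/memNset => /gen_inj E; rewrite E eqxx in l'l.
Qed.

Lemma step_null i : P (s i @^-1` (~` range gen)) = 0%E.
Proof.
rewrite step_prob big1 // => l _.
rewrite (_ : gen l \in _ = false) ?mulr0 //.
by apply/memNset; apply; exists l.
Qed.

Lemma walkS n w : walk s n.+1 w = (walk s n w * s n w)%g.
Proof. by rewrite /walk big_ord_recr. Qed.

(** The group is countable, so the event splits over the possible values at the
    previous time. *)
Lemma measurable_walk n (A : set basilica) : measurable (walk s n @^-1` A).
Proof.
elim: n A => [|n IH] A.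
  have -> : walk s 0 @^-1` A = if 1%g \in A then setT else set0.
    apply/seteqP; split=> w; rewrite /walk /= big_ord0; case: ifP => //;
      rewrite ?inE //.
    by move/negbT; rewrite notin_setE.
  by case: ifP.
pose val k := word_value (odflt [::] (unpickle k)).
have -> : walk s n.+1 @^-1` A = \bigcup_k
    ((walk s n @^-1` [set val k]) `&` (s n @^-1` [set h | A (val k * h)%g])).
  apply/seteqP; split=> [w /= Aw|w [k _] [/= <-]]; last by rewrite -walkS.
  have [u uE] := word_value_surj (walk s n w).
  by exists (pickle u); rewrite //= /val pickleK /= uE -walkS.
by apply: bigcupT_measurable => k; apply: measurableI => //; exact: measurable_step.
Qed.

Definition cylinder (u : seq letter) : set T :=
  [set w | forall j, (j < size u)%N -> s j w = gen (nth (false, false) u j)].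

Lemma cylinder_prob u : P (cylinder u) = (\prod_(l <- u) step_weight r l)%:E.
Proof.
pose A i := [set gen (nth (false, false) u i)].
have -> : cylinder u = \bigcap_(i in [set` iota 0 (size u)]) (s i @^-1` A i).
  apply/seteqP; split=> w h j; first by rewrite /= mem_iota add0n => /h.
  by move=> ju; apply: (h j); rewrite /= mem_iota add0n.
have [_ indep] := steps; rewrite indep ?iota_uniq //.
rewrite (eq_bigr (fun i => (step_weight r (nth (false, false) u i))%:E)); last first.
  by move=> i _; exact: step_gen.
by rewrite prodEFin (big_nth (false, false)) /index_iota subn0.
Qed.

Lemma measurable_cylinder u : measurable (cylinder u).
Proof.
have -> : cylinder u = \bigcap_i
    (s i @^-1` [set g | (i < size u)%N -> g = gen (nth (false, false) u i)]).
  by apply/seteqP; split=> w h i => [_|]; apply: h.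
by apply: bigcapT_measurable => i; exact: measurable_step.
Qed.

Lemma cylinder_walk u w : cylinder u w -> walk s (size u) w = word_value u.
Proof.
move=> uw; rewrite /walk /word_value (big_nth (false, false)) big_mkord.
by apply: eq_bigr => i _; rewrite uw.
Qed.

Definition exceeds (y : R) (i n : nat) : set T :=
  [set w | exists2 j, (i <= j <= n)%N & y < (wlen (walk s j w))%:R].

Lemma measurable_exceeds y i n : measurable (exceeds y i n).
Proof.
have -> : exceeds y i n = \bigcup_(j in [set j | (i <= j <= n)%N])
    (walk s j @^-1` [set g | y < (wlen g)%:R]).
  by apply/seteqP; split=> w [j ? ?]; exists j.
by apply: bigcup_measurable => j _; exact: measurable_walk.
Qed.

(** Induction on the remaining time: off a null set the next step is one of the
    four letters, so that the cylinder of [u] splits into four cylinders. *)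
Lemma cylinder_exceeds_prob y n u :
  (P (cylinder u `&` exceeds y (size u) (size u + n)) <=
    ((\prod_(l <- u) step_weight r l) * hit_prob r y n (word_value u))%:E)%E.
Proof.
elim: n u => [|n IH] u /=.
  rewrite addn0; case: ltP => [_|uy].
    rewrite mulr1 -cylinder_prob; apply: le_measure => //; rewrite inE.
      by apply: measurableI; [exact: measurable_cylinder|exact: measurable_exceeds].
    exact: measurable_cylinder.
  rewrite mulr0 (_ : _ `&` _ = set0) ?measure0 //.
  rewrite -subset0 => w [/cylinder_walk uw [j]].
  by rewrite -eqn_leq => /eqP <-; rewrite uw ltNge uy.
case: ltP => [_|uy].
  rewrite mulr1 -cylinder_prob; apply: le_measure => //; rewrite inE.
    by apply: measurableI; [exact: measurable_cylinder|exact: measurable_exceeds].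
  exact: measurable_cylinder.
pose ev := exceeds y (size u).+1 (size u + n.+1).
pose null := s (size u) @^-1` (~` range gen).
have mnull : measurable null by exact: measurable_step.
have mev l : measurable (cylinder (rcons u l) `&` ev).
  by apply: measurableI; [exact: measurable_cylinder|exact: measurable_exceeds].
pose b : letter -> set T := fun l => cylinder (rcons u l) `&` ev.
have mb l : measurable (b l) := mev l.
have le_l l : (P (b l) <= ((\prod_(l <- u) step_weight r l) *
    (step_weight r l * hit_prob r y n (word_value u * gen l)%g))%:E)%E.
  have := IH (rcons u l); rewrite size_rcons addSnnS.
  rewrite -cats1 big_cat big_seq1 word_value_cat word_value_seq1 /= -mulrA.
  by rewrite cats1.
have cover : cylinder u `&` exceeds y (size u) (size u + n.+1) `<=`
    (b (true, true) `|` b (true, false)) `|` (b (false, true) `|` b (false, false))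
    `|` null.
  move=> w [uw [j /andP[uj jn] yj]].
  have evw : ev w.
    exists j => //; rewrite jn andbT ltn_neqAle uj andbT.
    by apply/eqP => uE; move: yj; rewrite -uE (cylinder_walk uw) ltNge uy.
  have [[l _ lw]|] := pselect (range gen (s (size u) w)); last by right.
  left; have bl : b l w.
    split=> // k; rewrite size_rcons ltnS leq_eqVlt nth_rcons => /orP[/eqP ->|ku].
      by rewrite ltnn eqxx lw.
    by rewrite ku uw.
  by case: l bl {lw} => [[] []] bl; [left; left|left; right|right; left|right; right].
apply: (@le_trans _ _ (P ((b (true, true) `|` b (true, false)) `|`
    (b (false, true) `|` b (false, false)) `|` null))).
  apply: le_measure cover; rewrite inE.
    by apply: measurableI; [exact: measurable_cylinder|exact: measurable_exceeds].
  by do !apply: measurableU.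
rewrite measureU0 //; last exact: step_null; last by do !apply: measurableU.
rewrite /markov sum_letter !mulrDr !EFinD.
apply: le_trans (measureU2 _ _ _) _; [by apply: measurableU|by apply: measurableU|].
by apply: leeD; apply: le_trans (measureU2 _ (mb _) (mb _)) _; apply: leeD; exact: le_l.
Qed.

Lemma walk_max_exceeds y n : 0 <= y ->
  [set w | y < (walk_max s n w)%:R] = exceeds y 1 n.
Proof.
move=> y0; apply/seteqP; split=> w /=; last first.
  move=> [j jn yj]; apply: lt_le_trans yj _; rewrite ler_nat /walk_max.
  by rewrite /wlen; apply: leq_bigmax_seq; rewrite ?mem_index_iota.
move=> ymax; apply: contrapT => no; move: ymax; apply/negP; rewrite -leNgt.
rewrite /walk_max big_seq; apply: (big_ind (fun m : nat => m%:R <= y)) => //.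
  by move=> a b ay yb; rewrite /maxn; case: ifP.
move=> i; rewrite mem_index_iota ltnS => i1n; rewrite leNgt; apply/negP => yi.
by apply: no; exists i.
Qed.

End Law.

Theorem corollary10 (R : realType) (r : R) (r_gt0 : 0 < r) :
  exists c : R, 0 < c /\
    forall (d : measure_display) (T : measurableType d) (P : probability T R)
      (s : nat -> {RV P >-> basilica}),
      walk_steps r s ->
      forall (lambda : R) (n : nat), 1 <= lambda -> (1 <= n)%N ->
        (P [set w | (lambda * n%:R `^ (5%:R / 6%:R) < (walk_max s n w)%:R)%R]
         < (c / lambda)%:E)%E.
Proof.
have [C [C0 tail]] := tail_bound r_gt0.
exists (4 * C + 1); split=> [|d T P s steps lambda n l1 n1]; first lra.
have l0 : 0 < lambda by lra.
set z := n%:R `^ _; have z0 : 0 <= z by exact: powR_ge0.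
rewrite (walk_max_exceeds _ _ (mulr_ge0 (ltW l0) z0)).
set y := lambda * z.
have mE i : measurable (exceeds s y i n) := measurable_exceeds s y i n.
have [lc|lc] := ltP lambda (4 * C + 1).
  apply: (@le_lt_trans _ _ 1%:E); first exact: probability_le1.
  by rewrite lte_fin ltr_pdivlMr // mul1r.
apply: (@le_lt_trans _ _ (4 * C / lambda)%:E); last first.
  by rewrite lte_fin ltr_pM2r ?invr_gt0 //; lra.
pose x := lambda / 2 * z.
have l2 : 0 < lambda / 2 by lra.
have C2 : C / (lambda / 2) <= 1 / 2 by rewrite ler_pdivrMr //; lra.
have x0 : 0 <= x by apply: mulr_ge0 => //; exact: ltW.
have half j : (j <= n)%N -> iter j (markov r) (longer x) 1%g <= 1 / 2.
  case: j => [_|j jn].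
    by rewrite /= /longer wlen1 ltNge x0 divr_ge0.
  apply: le_trans C2; apply: le_trans (tail j.+1 _ isT l2).
  apply: markov_le => // g; rewrite /longer ler_nat.
  have : lambda / 2 * j.+1%:R `^ (5 / 6) <= x.
    rewrite ler_wpM2l ?(ltW l2) //; apply: ge0_ler_powR; rewrite ?nnegrE ?ler_nat //.
  by case: (ltP x) => [xg hx|] //; rewrite (le_lt_trans hx xg).
apply: (@le_trans _ _ (hit_prob r (2 * x) n 1%g)%:E).
  have := cylinder_exceeds_prob r_gt0 steps (2 * x) n [::].
  rewrite big_nil mul1r /word_value big_nil; apply: le_trans.
  apply: le_measure; rewrite ?inE //.
    by apply: measurableI; [exact: measurable_cylinder|exact: measurable_exceeds].
  move=> w [j /andP[_ jn] yj]; split=> //; exists j => //.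
  by rewrite (_ : 2 * x = y) // /x /y; field.
rewrite lee_fin; apply: le_trans (hit_prob_le r_gt0 1%g half) _.
apply: le_trans (ler_wpM2l _ (tail n _ n1 l2)) _ => //.
by rewrite le_eqVlt; apply/orP; left; apply/eqP; field; rewrite gt_eqF.
Qed.
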